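(* Let $P$ be an irreducible probability kernel on a countable set $S$ and let $S'\subset S$ be finite. Then $P$ is strongly positive recurrent if and only if the following conditions are satisfied: (i) $\rho(P)=1$. (ii) There exist a function $f:S\to(0,\infty)$ and a constant $0<\varepsilon<1$ such that $Pf(x)<\infty$ for all $x\in S'$ and $Pf(x)\leq(1-\varepsilon)f(x)$ for all $x\in S\setminus S'$.
   Context: A probability kernel on a countable set $S$ is a nonnegative matrix $P=(P(x,y))_{x,y\in S}$ with $\sum_yP(x,y)=1$ for all $x\in S$; it is irreducible if for each $x,y\in S$ there is an $n\geq 1$ such that $P^n(x,y)>0$. We write $Pf(x):=\sum_{y\in S}P(x,y)f(y)\in[0,\infty]$. For irreducible $P$, the spectral radius is $\rho(P):=\lim_{n\to\infty}(P^n(x,x))^{1/n}$, where, if $P$ is periodic, $n$ ranges only through those integers for which $P^n(x,x)>0$; the limit exists and does not depend on $x\in S$. An irreducible probability kernel $P$ on $S$ is strongly positive recurrent if for some (equivalently all) $x\in S$ there is an $\varepsilon>0$ such that $\mathbb{E}^x[e^{\varepsilon\sigma_x}]<\infty$, where $\sigma_x:=\inf\{k>0:X_k=x\}$ is the first return time to $x$ of the Markov chain $(X_k)_{k\geq 0}$ with transition kernel $P$, and $\mathbb{E}^x$ denotes expectation for the chain started in $X_0=x$.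
   Formalization: The finite set S' is assumed nonempty: for S' empty the equivalence fails, e.g. for S a single point and P = 1, which is strongly positive recurrent although no f > 0 satisfies Pf ≤ (1−ε)f. *)

(* Defs.v *)
From HB Require Import structures.
From mathcomp Require Import all_boot all_order all_algebra.
From mathcomp Require Import all_classical all_reals all_analysis.

Set Implicit Arguments.
Unset Strict Implicit.
Unset Printing Implicit Defensive.

Import Order.TTheory GRing.Theory Num.Theory.
Import numFieldNormedType.Exports.

Local Open Scope classical_set_scope.
Local Open Scope ring_scope.

Definition is_probability_kernel (R : realType) (S : countType)
    (P : S -> S -> R) : Prop :=
  (forall x y, 0 <= P x y) /\
  (forall x, \esum_(y in [set: S]) (P x y)%:E = 1%E).

(* [fine] loses nothing when [P] is a probability kernel: the sum is then at
   most 1. *)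
Fixpoint kernel_pow (R : realType) (S : countType) (P : S -> S -> R)
    (n : nat) (x y : S) : R :=
  if n is m.+1 then
    fine (\esum_(z in [set: S]) (P x z * kernel_pow P m z y)%:E)
  else (x == y)%:R.

Definition irreducible_kernel (R : realType) (S : countType)
    (P : S -> S -> R) : Prop :=
  forall x y, exists2 n, (0 < n)%N & 0 < kernel_pow P n x y.

(* [Pf], to be used with [f] nonnegative. *)
Definition kernel_app (R : realType) (S : countType) (P : S -> S -> R)
    (f : S -> R) (x : S) : \bar R :=
  \esum_(y in [set: S]) (P x y * f y)%:E.

(* The common limit, over all base points [x], of [P^n(x,x)^(1/n)] along the
   [n] with [P^n(x,x) > 0]. The default value 0 is returned if there is no such
   limit, which does not happen for irreducible [P] on a nonempty [S]. *)
Definition spectral_radius (R : realType) (S : countType)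
    (P : S -> S -> R) : R :=
  xget 0 [set r : R | forall x : S,
    kernel_pow P n x x `^ (n%:R^-1)
      @[n --> within [set n | 0 < kernel_pow P n x x] \oo] --> r].

(* [X] is a Markov chain with transition kernel [P] started in [x]; [S] carries
   the discrete sigma-algebra. The last clause is the Markov property
   [Pr(X_{n+1} = y | X_0 = s_0, .., X_n = s_n) = P(s_n, y)], multiplied by the
   probability of the conditioning event so that this may be null. *)
Definition markov_chain (R : realType) (S : countType) (P : S -> S -> R)
    (x : S) (d : measure_display) (T : measurableType d)
    (Pr : probability T R) (X : nat -> T -> S) : Prop :=
  [/\ forall k y, measurable [set w | X k w = y],
      Pr [set w | X 0%N w = x] = 1%E &
      forall (n : nat) (s : nat -> S) (y : S),
        Pr ([set w | forall k, (k <= n)%N -> X k w = s k]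
              `&` [set w | X n.+1 w = y])
        = (Pr [set w | forall k, (k <= n)%N -> X k w = s k]
             * (P (s n) y)%:E)%E].

(* The infimum of the empty set is [+oo]. *)
Definition return_time (R : realType) (S : countType) (T : Type)
    (X : nat -> T -> S) (x : S) (w : T) : \bar R :=
  ereal_inf [set k%:R%:E | k in [set k : nat | (0 < k)%N /\ X k w = x]].

(* The law of the chain, hence the expectation, is determined by [P] and [x],
   so the choice of the probability space and of the chain is immaterial. *)
Definition strongly_positive_recurrent (R : realType) (S : countType)
    (P : S -> S -> R) : Prop :=
  exists (x : S) (e : R), 0 < e /\
  exists (d : measure_display) (T : measurableType d)
         (Pr : probability T R) (X : nat -> T -> S),
    markov_chain P x Pr X /\
    (\int[Pr]_w expeR (e%:E * return_time R X x w) < +oo)%E.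

(* Main.v *)
Require Import Defs.
From HB Require Import structures.
From mathcomp Require Import all_boot all_order all_algebra.
From mathcomp Require Import all_classical all_reals all_analysis.
From mathcomp Require Import measurable_realfun.
From mathcomp Require Import ring lra zify.

(** Everything is expressed through the generating functions of hitting times.
    For a state x, let tau be the hitting time of x (time 0 included) and sigma
    the return time to x, and put G_z(y) = E^y[z^tau; tau < oo] and
    F(z) = E^x[z^sigma; sigma < oo]. Splitting off the first step gives
    z P G_z = G_z off x, z P G_z (x) = F(z) and G_z(x) = 1
    ([hit_gen_step], [return_gen_step], [hit_gen_self]).

    Computing with a chain shows that
    E^x[e^(c sigma)] = oo * (1 - F(1)) + F(e^c) ([exp_return_time_integral]),
    so strong positive recurrence at x says that F(1) = 1 and F(l) < oo for some
    l > 1. A Markov chain does exist ([unit_chain_markov]): it is read off a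
    uniform point of the unit interval, by nested subdivisions.

    The drift condition for the one-point set {x} is equivalent to F(l) < oo for
    some l > 1. If F(l) < oo, then G_l is finite by irreducibility and is a drift
    function with 1 - eps = 1/l ([return_gen_drift_condition]); conversely G_l is
    the least supersolution of z P h <= h off x with value at least 1 at x, so it
    lies below any drift function normalized at x ([drift_condition_return_gen]).

    The heart of the matter is that the drift condition does not depend on the
    finite set ([drift_condition_set1]). Given a drift function f for the finite
    set D, and any state x, the function w = 2 - G_(1/2) lies between 1 and 2 and
    satisfies P w < w at every point other than x. By Hoelder's inequality, a
    weighted geometric mean h of w and f is such that P h is at most the same
    mean of P w and P f. Off D and x, the factor f contributes a contraction by a
    fixed factor. At the points of D other than x, where P f / f is merely finite,
    the factor w dominates as soon as its weight is close enough to 1; this is a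
    finite number of requirements.

    It remains to trade F(1) = 1 against rho(P) = 1. The renewal equation
    P^(n+1)(x,x) = sum_k P(sigma = k+1) P^(n-k)(x,x) shows that F(1) = 1 forces
    sum_n P^n(x,x) = oo ([recurrent_green_infinite]); hence P^n(y,y) decays
    geometrically for no y, and supermultiplicativity turns this into
    P^n(y,y)^(1/n) -> 1 ([supermul_root_cvg1]). Conversely, if F(1) < 1 and
    F(l) < oo for some l > 1, then by convexity F(z) <= 1 for some z > 1, and the
    renewal equation yields P^n(x,x) <= z^(-n) by induction, so that rho(P) < 1
    ([spectral_radius1_recurrent]). *)

Set Implicit Arguments.
Unset Strict Implicit.
Unset Printing Implicit Defensive.

Import Order.TTheory GRing.Theory Num.Theory.
Import numFieldNormedType.Exports.

Local Open Scope classical_set_scope.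
Local Open Scope ring_scope.

(** * Sums of nonnegative extended reals *)

Section NonnegativeSums.
Context {R : realType}.
Local Open Scope ereal_scope.

Lemma esumZl (T : choiceType) (I : set T) (c : R) (a : T -> \bar R) :
    (0 <= c)%R -> (forall i, I i -> 0 <= a i) ->
  \esum_(i in I) (c%:E * a i) = c%:E * \esum_(i in I) a i.
Proof.
have leZ (d : R) (b : T -> \bar R) : (0 <= d)%R -> (forall i, I i -> 0 <= b i) ->
    \esum_(i in I) (d%:E * b i) <= d%:E * \esum_(i in I) b i.
  move=> d0 b0; apply: ge_ereal_sup => _ [X [finX XI] <-].
  have -> : \sum_(i \in X) (d%:E * b i) = d%:E * \sum_(i \in X) b i.
    rewrite !fsbig_finite//= big_seq [in RHS]big_seq ge0_sume_distrr// => i.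
    by rewrite in_fset_set// inE => /XI/b0.
  by rewrite lee_wpmul2l ?lee_fin// ereal_sup_ubound//; exists X.
rewrite le_eqVlt => /predU1P[<- a0|c0 a0].
  by rewrite mul0e esum1// => i _; rewrite mul0e.
apply/eqP; rewrite eq_le leZ//= ?(ltW c0)//.
rewrite -lee_pdivlMl//; apply: (le_trans _ (leZ c^-1%R (fun i => c%:E * a i) _ _)); first 1 last.
- by rewrite invr_ge0 ltW.
- by move=> i /a0 ?; rewrite mule_ge0// lee_fin ltW.
- by apply: le_esum => i _; rewrite muleA -EFinM mulVf ?gt_eqF// mul1e.
Qed.

Lemma esum_ge1 (T : choiceType) (I : set T) (a : T -> \bar R) i :
  I i -> (forall j, I j -> 0 <= a j) -> a i <= \esum_(j in I) a j.
Proof.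
move=> Ii a0; apply: esum_ge; exists [set i]; last by rewrite fsbig_set1.
by split; [exact: finite_set1|move=> _ ->].
Qed.

Lemma esum_gt0 (T : choiceType) (I : set T) (a : T -> \bar R) :
  0 < \esum_(i in I) a i -> exists2 i, I i & 0 < a i.
Proof.
move=> s0; apply: contrapT => no.
have: \esum_(i in I) a i <= \esum_(i in I) (cst 0 i : \bar R).
  by apply: le_esum => i Ii; rewrite leNgt; apply/negP => ai; apply: no; exists i.
by rewrite (esum1 (a := cst 0))// leNgt s0.
Qed.

Lemma exchange_esum (T1 T2 : choiceType) (a : T1 -> T2 -> \bar R) :
    (forall i j, 0 <= a i j) ->
  \esum_(i in [set: T1]) \esum_(j in [set: T2]) a i j =
  \esum_(j in [set: T2]) \esum_(i in [set: T1]) a i j.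
Proof.
move=> a0; rewrite !(@esum_esum _ _ _ _ (fun=> setT))//.
rewrite (reindex_esum ([set: T2] `*`` fun=> [set: T1]) _ (fun x => (x.2, x.1)))//.
split=> //=; first by move=> [i1 i2] [j1 j2] /= _ _ [] -> ->.
by move=> [i1 i2] _ /=; exists (i2, i1).
Qed.

Lemma esum_nat_le (a : nat -> \bar R) (c : \bar R) : (forall n, 0 <= a n) ->
  (forall n, \sum_(k < n) a k <= c) -> \esum_(k in [set: nat]) a k <= c.
Proof.
move=> a0 ac; rewrite -nneseries_esumT//.
apply: lime_le; first exact: is_cvg_nneseries.
by apply: nearW => n; rewrite big_mkord; exact: ac.
Qed.

Lemma le_sum_esum_nat (a : nat -> \bar R) n : (forall n, 0 <= a n) ->
  \sum_(k < n) a k <= \esum_(k in [set: nat]) a k.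
Proof.
move=> a0; rewrite -nneseries_esumT// -(big_mkord xpredT).
by apply: nneseries_lim_ge => i _ _; exact: a0.
Qed.

Lemma esum_nat_recl (a : nat -> \bar R) : (forall n, 0 <= a n) ->
  \esum_(k in [set: nat]) a k = a 0%N + \esum_(k in [set: nat]) a k.+1.
Proof.
move=> a0; apply/eqP; rewrite eq_le; apply/andP; split.
  apply: esum_nat_le => // -[|n].
    by rewrite big_ord0 adde_ge0// esum_ge0.
  by rewrite big_ord_recl leeD2l// (le_sum_esum_nat n (fun k => a0 k.+1)).
have [ya|] := eqVneq (a 0%N) +oo.
  have : a 0%N <= \esum_(k in [set: nat]) a k by exact: esum_ge1.
  by rewrite ya leye_eq => /eqP ->; rewrite leey.
move=> ya; have fa : a 0%N \is a fin_num by rewrite ge0_fin_numE// lt_neqAle ya leey.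
rewrite addeC -leeBrDr//; apply: esum_nat_le => // n.
rewrite leeBrDr// addeC.
by have := le_sum_esum_nat n.+1 a0; rewrite big_ord_recl.
Qed.

Lemma sum_ord_esum_nat (F : nat -> \bar R) n : (forall k, 0 <= F k) ->
  \sum_(k < n) F k = \esum_(k in [set: nat]) (if (k < n)%N then F k else 0).
Proof.
elim: n F => [|n IH] F F0; first by rewrite big_ord0 esum1.
rewrite big_ord_recl esum_nat_recl /=; last by move=> k; case: ifP.
by rewrite (IH (fun k => F k.+1)).
Qed.

Lemma esum_nat_shift (F : nat -> \bar R) k : (forall j, 0 <= F j) ->
  \esum_(n in [set: nat]) (if (k <= n)%N then F (n - k)%N else 0) =
  \esum_(n in [set: nat]) F n.
Proof.
move=> F0; elim: k => [|k IH]; first by apply: eq_esum => n _; rewrite subn0.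
rewrite esum_nat_recl; last by move=> j; case: ifP.
by rewrite add0e -[RHS]IH; apply: eq_esum => n _; rewrite ltnS subSS.
Qed.

Lemma geometric_esum_lty (C q : R) : (0 <= C)%R -> (0 < q < 1)%R ->
  \esum_(n in [set: nat]) (C * q ^+ n)%:E < +oo.
Proof.
move=> C0 /andP[q0 q1]; apply: (@le_lt_trans _ _ (C / (1 - q))%:E); last exact: ltry.
apply: esum_nat_le => n; first by rewrite lee_fin mulr_ge0// exprn_ge0// ltW.
rewrite sumEFin lee_fin -mulr_sumr ler_wpM2l// -[leRHS]mul1r ler_pdivlMr ?subr_gt0//.
rewrite mulrC -opprB mulNr -subrX1 opprB lerBlDr lerDl exprn_ge0// ltW//.
Qed.

End NonnegativeSums.

(** * The kernel as an operator on nonnegative functions *)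

(** Unlike in [kernel_app], infinite values of [f] are allowed: the generating
    functions of hitting times to which it is applied may be infinite. *)
Definition kernel_op (R : realType) (S : countType) (P : S -> S -> R)
    (f : S -> \bar R) (x : S) : \bar R :=
  (\esum_(y in [set: S]) ((P x y)%:E * f y))%E.

Section KernelOperator.
Context {R : realType} {S : countType} {P : S -> S -> R}.
Hypothesis hP : is_probability_kernel P.
Local Notation op := (kernel_op P).
Local Open Scope ereal_scope.

Lemma kernel_ge0 x y : (0 <= P x y)%R.
Proof. by case: hP => /(_ x y). Qed.

Lemma kernel_op_ge0 f x : (forall y, 0 <= f y) -> 0 <= op f x.
Proof.
by move=> f0; apply: esum_ge0 => y _; rewrite mule_ge0 ?lee_fin ?kernel_ge0.
Qed.

Lemma le_kernel_op f g x : (forall y, f y <= g y) -> op f x <= op g x.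
Proof.
by move=> fg; apply: le_esum => y _; rewrite lee_wpmul2l ?lee_fin ?kernel_ge0.
Qed.

Lemma eq_kernel_op f g x : (forall y, f y = g y) -> op f x = op g x.
Proof. by move=> fg; apply: eq_esum => y _; rewrite fg. Qed.

Lemma kernel_opD f g x : (forall y, 0 <= f y) -> (forall y, 0 <= g y) ->
  op (fun y => f y + g y) x = op f x + op g x.
Proof.
move=> f0 g0; rewrite /kernel_op -esumD;
  do 1?[by move=> *; rewrite mule_ge0 ?lee_fin ?kernel_ge0].
by apply: eq_esum => y _; rewrite ge0_muleDr.
Qed.

Lemma kernel_opZ (c : R) f x : (0 <= c)%R -> (forall y, 0 <= f y) ->
  op (fun y => c%:E * f y) x = c%:E * op f x.
Proof.
move=> c0 f0; rewrite /kernel_op -esumZl//; last first.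
  by move=> y _; rewrite mule_ge0 ?lee_fin ?kernel_ge0.
by apply: eq_esum => y _; rewrite muleCA.
Qed.

Lemma kernel_op1 x : op (cst 1) x = 1.
Proof.
by rewrite -[RHS](hP.2 x); apply: eq_esum => y _; rewrite /= mule1.
Qed.

Lemma kernel_op_cst (c : R) x : (0 <= c)%R -> op (cst c%:E) x = c%:E.
Proof.
move=> c0; rewrite (eq_kernel_op (g := fun y => c%:E * cst 1 y)); last first.
  by move=> y; rewrite /= mule1.
by rewrite kernel_opZ// kernel_op1 mule1.
Qed.

Lemma kernel_op_sum (I : Type) (s : seq I) (Q : pred I) (f : I -> S -> \bar R) x :
  (forall i y, 0 <= f i y) ->
  op (fun y => \sum_(i <- s | Q i) f i y) x = \sum_(i <- s | Q i) op (f i) x.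
Proof.
move=> f0; elim: s => [|i s IH].
  by rewrite big_nil /kernel_op esum1// => y _; rewrite big_nil mule0.
rewrite big_cons -IH; case: ifPn => Qi.
  rewrite -kernel_opD//; first by apply: eq_kernel_op => y; rewrite big_cons Qi.
  by move=> y; apply: sume_ge0.
by apply: eq_kernel_op => y; rewrite big_cons (negbTE Qi).
Qed.

Lemma kernel_op_esum (f : nat -> S -> \bar R) x : (forall n y, 0 <= f n y) ->
  op (fun y => \esum_(n in [set: nat]) f n y) x =
  \esum_(n in [set: nat]) op (f n) x.
Proof.
move=> f0; rewrite /kernel_op exchange_esum; last first.
  by move=> *; rewrite mule_ge0 ?lee_fin ?kernel_ge0.
by apply: eq_esum => y _; rewrite esumZl ?kernel_ge0.
Qed.

Lemma kernel_op_ge f x y : (forall y, 0 <= f y) -> (P x y)%:E * f y <= op f x.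
Proof.
by move=> f0; apply: (@esum_ge1 _ _ setT (fun y => _ * f y)) => // z _;
  rewrite mule_ge0 ?lee_fin ?kernel_ge0.
Qed.

Lemma kernel_appE (f : S -> R) x : kernel_app P f x = op (EFin \o f) x.
Proof. by apply: eq_esum => y _; rewrite EFinM. Qed.

End KernelOperator.

(** * Powers of the kernel *)

Section KernelPowers.
Context {R : realType} {S : countType} {P : S -> S -> R}.
Hypothesis hP : is_probability_kernel P.
Local Notation op := (kernel_op P).
Local Notation K := (kernel_pow P).
Local Open Scope ereal_scope.

Let op_itv f x : (forall y, 0 <= f y <= 1) -> 0 <= op f x <= 1.
Proof.
move=> f01; rewrite (kernel_op_ge0 hP)/=; last by move=> y; case/andP: (f01 y).
by rewrite -(kernel_op1 hP x) (le_kernel_op hP)// => y; case/andP: (f01 y).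
Qed.

Let powSE n x y : (forall z, 0 <= K n z y <= 1)%R ->
  (K n.+1 x y)%:E = op (fun z => (K n z y)%:E) x.
Proof.
move=> K01; have /andP[op0 op1] : 0 <= op (fun z => (K n z y)%:E) x <= 1.
  by apply: op_itv => z; rewrite !lee_fin.
rewrite -[K n.+1 x y]/(fine (\esum_(z in [set: S]) (P x z * K n z y)%:E)).
have -> : \esum_(z in [set: S]) (P x z * K n z y)%:E = op (fun z => (K n z y)%:E) x.
  by apply: eq_esum => z _; rewrite EFinM.
by rewrite fineK// ge0_fin_numE// (le_lt_trans op1)// ltry.
Qed.

Let pow_itv n x y : (0 <= K n x y <= 1)%R.
Proof.
elim: n x => [|n IH] x; first by rewrite /= ler0n lern1; case: (_ == _).
by rewrite -!lee_fin powSE//; apply: op_itv => z; rewrite !lee_fin.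
Qed.

Lemma kernel_pow_ge0 n x y : (0 <= K n x y)%R.
Proof. by case/andP: (pow_itv n x y). Qed.

Lemma kernel_pow_le1 n x y : (K n x y <= 1)%R.
Proof. by case/andP: (pow_itv n x y). Qed.

Lemma kernel_powS n x y : (K n.+1 x y)%:E = op (fun z => (K n z y)%:E) x.
Proof. by apply: powSE. Qed.

Lemma kernel_pow_supermul m n x y z : (K m x z * K n z y <= K (m + n) x y)%R.
Proof.
elim: m x => [|m IH] x.
  rewrite /= add0n; have [->|_] := eqVneq x z; first by rewrite mul1r.
  by rewrite mul0r kernel_pow_ge0.
rewrite addSn -lee_fin EFinM !kernel_powS muleC -kernel_opZ//; last first.
- by move=> ?; rewrite lee_fin kernel_pow_ge0.
- exact: kernel_pow_ge0.
apply: (le_kernel_op hP) => w.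
by rewrite -EFinM lee_fin mulrC.
Qed.

Lemma kernel_powS_gt0 n x y : (0 < K n.+1 x y)%R ->
  exists2 z, (0 < P x z)%R & (0 < K n z y)%R.
Proof.
rewrite -lte_fin kernel_powS => /esum_gt0[z _].
rewrite -EFinM lte_fin => h; exists z.
  rewrite lt_neqAle (kernel_ge0 hP) andbT eq_sym.
  by apply: contraTneq h => ->; rewrite mul0r ltxx.
rewrite lt_neqAle kernel_pow_ge0 andbT eq_sym.
by apply: contraTneq h => ->; rewrite mulr0 ltxx.
Qed.

End KernelPowers.

(** * Generating functions of hitting and return times *)

Section HittingTimes.
Context {R : realType} {S : countType}.
Implicit Types (P : S -> S -> R) (x y : S).
Local Open Scope ereal_scope.

(** The probability that the chain started in [y] visits [x] for the first time
    at time [n], where a visit at time 0 counts. *)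
Fixpoint hit_prob P x (n : nat) (y : S) : \bar R :=
  if n is m.+1 then if y == x then 0 else kernel_op P (hit_prob P x m) y
  else (y == x)%:R%:E.

(** The probability that the first return to [x] takes place at time [n.+1]. *)
Definition return_prob P x (n : nat) : \bar R :=
  kernel_op P (hit_prob P x n) x.

Definition hit_gen P x (z : R) (y : S) : \bar R :=
  \esum_(n in [set: nat]) ((z ^+ n)%:E * hit_prob P x n y).

Definition return_gen P x (z : R) : \bar R :=
  \esum_(n in [set: nat]) ((z ^+ n.+1)%:E * return_prob P x n).

End HittingTimes.

Section HittingTheory.
Context {R : realType} {S : countType} {P : S -> S -> R}.
Hypothesis hP : is_probability_kernel P.
Local Notation op := (kernel_op P).
Local Notation K := (kernel_pow P).
Local Open Scope ereal_scope.
Implicit Types (x y : S) (z : R).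

Lemma hit_prob_ge0 x n y : 0 <= hit_prob P x n y.
Proof.
elim: n y => [|n IH] y /=; first by rewrite lee_fin ler0n.
by case: ifP => // _; exact: kernel_op_ge0.
Qed.

Lemma hit_probS_self x n : hit_prob P x n.+1 x = 0.
Proof. by rewrite /= eqxx. Qed.

Lemma hit_probS x n y : y != x -> hit_prob P x n.+1 y = op (hit_prob P x n) y.
Proof. by move=> /negbTE/= ->. Qed.

Lemma return_prob_ge0 x n : 0 <= return_prob P x n.
Proof. by apply: kernel_op_ge0 => // y; exact: hit_prob_ge0. Qed.

Let term_ge0 x z n y : (0 <= z)%R -> 0 <= (z ^+ n)%:E * hit_prob P x n y.
Proof. by move=> z0; rewrite mule_ge0 ?hit_prob_ge0// lee_fin exprn_ge0. Qed.

Lemma hit_gen_ge0 x z y : (0 <= z)%R -> 0 <= hit_gen P x z y.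
Proof. by move=> z0; apply: esum_ge0 => n _; exact: term_ge0. Qed.

Lemma hit_gen_self x z : (0 <= z)%R -> hit_gen P x z x = 1.
Proof.
move=> z0; rewrite /hit_gen esum_nat_recl; last by move=> n; exact: term_ge0.
rewrite /= eqxx mule1 expr0 esum1 ?adde0// => n _.
by rewrite mule0.
Qed.

Let op_hit_gen x z y : (0 <= z)%R -> z%:E * op (hit_gen P x z) y =
  \esum_(n in [set: nat]) ((z ^+ n.+1)%:E * op (hit_prob P x n) y).
Proof.
move=> z0; rewrite kernel_op_esum//; last by move=> n w; exact: term_ge0.
rewrite -esumZl//; last first.
  by move=> n _; apply: kernel_op_ge0 => // w; exact: term_ge0.
apply: eq_esum => n _; rewrite kernel_opZ ?exprn_ge0//; last first.
  by move=> w; exact: hit_prob_ge0.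
by rewrite muleA -EFinM -exprS.
Qed.

Lemma hit_gen_step x z y : (0 <= z)%R -> y != x ->
  z%:E * op (hit_gen P x z) y = hit_gen P x z y.
Proof.
move=> z0 yx; rewrite op_hit_gen// [RHS]esum_nat_recl; last first.
  by move=> n; exact: term_ge0.
rewrite /= (negbTE yx) mule0 add0e.
by apply: eq_esum => n _.
Qed.

Lemma return_gen_step x z : (0 <= z)%R ->
  z%:E * op (hit_gen P x z) x = return_gen P x z.
Proof. exact: op_hit_gen. Qed.

(** The generating function of the hitting time is the least supersolution of
    the equation in [hit_gen_step] that is at least 1 at [x]: each of its partial
    sums arises from the previous one by applying the operator once. *)
Lemma hit_gen_le x z (h : S -> \bar R) : (0 <= z)%R ->
    (forall y, 0 <= h y) -> 1 <= h x ->
    (forall y, y != x -> z%:E * op h y <= h y) ->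
  forall y, hit_gen P x z y <= h y.
Proof.
move=> z0 h0 hx hstep y; apply: esum_nat_le => [n|n]; first exact: term_ge0.
elim: n y => [|n IH] y; first by rewrite big_ord0.
rewrite big_ord_recl /=; have [->|yx] := eqVneq y x.
  by rewrite big1 ?adde0 ?mule1// => i _; rewrite mule0.
rewrite mule0 add0e; apply: le_trans (hstep _ yx).
apply: le_trans (lee_wpmul2l _ (le_kernel_op hP y IH)); last by rewrite lee_fin.
rewrite kernel_op_sum//; last by move=> i w; exact: term_ge0.
rewrite ge0_sume_distrr; last first.
  by move=> i _; apply: kernel_op_ge0 => // w; exact: term_ge0.
apply: lee_sum => i _; rewrite kernel_opZ ?exprn_ge0//; last first.
  by move=> w; exact: hit_prob_ge0.
by rewrite muleA -EFinM -exprS.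
Qed.

Lemma hit_gen1_le1 x y : hit_gen P x 1 y <= 1.
Proof.
apply: (hit_gen_le (h := cst 1)) => // w _.
by rewrite mul1e kernel_op1.
Qed.

Lemma return_gen1_le1 x : return_gen P x 1 <= 1.
Proof.
rewrite -return_gen_step// mul1e -(kernel_op1 hP x).
by apply: le_kernel_op => // y; exact: hit_gen1_le1.
Qed.

Lemma le_hit_gen x z1 z2 y : (0 <= z1 <= z2)%R ->
  hit_gen P x z1 y <= hit_gen P x z2 y.
Proof.
move=> /andP[z10 z12]; apply: le_esum => n _.
by rewrite lee_wpmul2r ?hit_prob_ge0// lee_fin lerXn2r// nnegrE (le_trans z10).
Qed.

(** Decomposition of the event of being in [x] at time [n] according to the time
    of the first visit to [x]. *)
Lemma hit_prob_renewal x n y :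
  (K n y x)%:E = \sum_(k < n.+1) hit_prob P x k y * (K (n - k) x x)%:E.
Proof.
elim: n y => [|n IH] y.
  by rewrite big_ord_recl big_ord0 adde0 /= eqxx mule1.
have [->|yx] := eqVneq y x.
  rewrite big_ord_recl big1 ?adde0; last by move=> i _; rewrite hit_probS_self mul0e.
  by rewrite [hit_prob _ _ _ _]/= eqxx mul1e subn0.
rewrite kernel_powS// (eq_kernel_op _ IH) kernel_op_sum//; last first.
  by move=> i w; rewrite mule_ge0 ?hit_prob_ge0// lee_fin kernel_pow_ge0.
rewrite [RHS]big_ord_recl [X in X * _]/= (negbTE yx) mul0e add0e.
apply: eq_bigr => i _; rewrite hit_probS// lift0 subSS.
under eq_kernel_op do rewrite muleC.
rewrite kernel_opZ// 1?muleC//; last by move=> w; exact: hit_prob_ge0.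
exact: kernel_pow_ge0.
Qed.

Lemma return_prob_renewal x n :
  (K n.+1 x x)%:E = \sum_(k < n.+1) return_prob P x k * (K (n - k) x x)%:E.
Proof.
rewrite kernel_powS// (eq_kernel_op _ (hit_prob_renewal _ _)).
rewrite kernel_op_sum//; last first.
  by move=> i w; rewrite mule_ge0 ?hit_prob_ge0// lee_fin kernel_pow_ge0.
apply: eq_bigr => i _.
under eq_kernel_op do rewrite muleC.
rewrite kernel_opZ// 1?muleC//; last by move=> w; exact: hit_prob_ge0.
exact: kernel_pow_ge0.
Qed.

Hypothesis hirr : irreducible_kernel P.

Lemma hit_gen_gt0 x z y : (0 < z)%R -> 0 < hit_gen P x z y.
Proof.
move=> z0; have [n _] := hirr y x.
rewrite -lte_fin hit_prob_renewal => Kgt0.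
have [k hk] : exists k, 0 < hit_prob P x k y.
  apply: contrapT => no; move: Kgt0; rewrite big1 ?ltxx// => k _.
  have [->|h] := eqVneq (hit_prob P x k y) 0; first by rewrite mul0e.
  by exfalso; apply: no; exists k; rewrite lt_def h hit_prob_ge0.
apply: (@lt_le_trans _ _ ((z ^+ k)%:E * hit_prob P x k y)).
  by rewrite mule_gt0// lte_fin exprn_gt0.
apply: (@esum_ge1 _ _ _ (fun n => (z ^+ n)%:E * hit_prob P x n y)) => // j _.
by apply: term_ge0; exact: ltW.
Qed.

(** Finiteness propagates along the edges of the kernel: if the generating
    function is finite at [w], so is its image under the operator at [w], hence
    its value at each successor of [w]. Starting from [x], this reaches every
    state. *)
Lemma hit_gen_lty x z y : (0 < z)%R -> return_gen P x z < +oo ->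
  hit_gen P x z y < +oo.
Proof.
move=> z0 Foo.
have opoo w : hit_gen P x z w < +oo -> op (hit_gen P x z) w < +oo.
  move=> Hoo; have : z%:E * op (hit_gen P x z) w < +oo.
    have [->|wx] := eqVneq w x; first by rewrite return_gen_step// ltW.
    by rewrite hit_gen_step// ltW.
  apply: contraTT; rewrite -!leNgt !leye_eq => /eqP ->.
  by rewrite gt0_muley ?lte_fin.
have step n w v : (0 < K n w v)%R -> hit_gen P x z w < +oo -> hit_gen P x z v < +oo.
  elim: n w => [|n IH] w; first by rewrite /=; case: eqVneq => [->|_]; rewrite ?ltxx.
  move=> /(kernel_powS_gt0 hP)[u Pwu Kuv] /opoo Hw; apply: IH Kuv _.
  apply: contraTT (Hw); rewrite -!leNgt !leye_eq => /eqP Hu.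
  rewrite -leye_eq -(@gt0_muley _ (P w u)%:E) ?lte_fin// -Hu kernel_op_ge// => t.
  by apply: hit_gen_ge0; exact: ltW.
have [n _ Kxy] := hirr x y.
by apply: step Kxy _; rewrite hit_gen_self ?ltW// ltry.
Qed.

End HittingTheory.

(** * The drift condition and its independence of the finite set *)

Definition drift_condition (R : realType) (S : countType) (P : S -> S -> R)
    (A : set S) : Prop :=
  exists (f : S -> R) (e : R),
    [/\ forall x, 0 < f x,
        0 < e < 1,
        forall x, A x -> (kernel_app P f x < +oo)%E &
        forall x, ~ A x -> (kernel_app P f x <= ((1 - e) * f x)%:E)%E].

Section WeightedGeometricMean.
Context {R : realType}.
Implicit Types (a b : R) (n : nat).

(** The geometric mean of [a] and [b] with weights [n / n.+1] and [1 / n.+1]. *)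
Definition geo_mean n a b : R := expR ((n%:R * ln a + ln b) / n.+1%:R).

Lemma geo_mean_gt0 n a b : 0 < geo_mean n a b.
Proof. exact: expR_gt0. Qed.

(** The inequality of arithmetic and geometric means for [a / a0] and [b / b0].
    It follows from the tangent inequality [exp r >= exp m * (1 + (r - m))] at the
    weighted mean [m] of the two exponents, since the linear terms cancel. *)
Lemma geo_mean_le n a b a0 b0 : 0 < a -> 0 < b -> 0 < a0 -> 0 < b0 ->
  geo_mean n a b <= geo_mean n a0 b0 *
    ((n%:R / n.+1%:R / a0) * a + (n.+1%:R^-1 / b0) * b).
Proof.
move=> ap bp a0p b0p.
have E (c c0 : R) : 0 < c -> 0 < c0 -> c0^-1 * c = expR (ln c - ln c0).
  by move=> cp c0p; rewrite expRB !lnK ?posrE// mulrC.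
rewrite -!mulrA (E a a0)// (E b b0)// /geo_mean.
set s := ln a - ln a0; set t := ln b - ln b0.
have np : 0 < n.+1%:R :> R by rewrite ltr0n.
have -> : (n%:R * ln a + ln b) / n.+1%:R =
    (n%:R * ln a0 + ln b0) / n.+1%:R + (n%:R * s + t) / n.+1%:R.
  by rewrite /s /t; field; rewrite gt_eqF.
rewrite expRD ler_pM2l ?expR_gt0//; set m := _ / n.+1%:R.
have tan r : expR m * (1 + (r - m)) <= expR r.
  rewrite [leRHS](_ : _ = expR m * expR (r - m)); last by rewrite -expRD addrC subrK.
  by rewrite ler_pM2l ?expR_gt0// expR_ge1Dx.
have -> : expR m = n%:R * (n.+1%:R^-1 * (expR m * (1 + (s - m)))) +
    n.+1%:R^-1 * (expR m * (1 + (t - m))).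
  have nE : n.+1%:R = 1 + n%:R :> R by rewrite -natr1 addrC.
  have : n.+1%:R * m = n%:R * s + t by rewrite /m mulrCA divff ?gt_eqF// mulr1.
  move: np; rewrite nE => np hm.
  have : (1 + n%:R) * (expR m - (n%:R * ((1 + n%:R)^-1 * (expR m * (1 + (s - m)))) +
    (1 + n%:R)^-1 * (expR m * (1 + (t - m))))) = 0.
    transitivity (expR m * ((1 + n%:R) * m - (n%:R * s + t))).
      by field; rewrite gt_eqF.
    by rewrite hm subrr mulr0.
  by move/eqP; rewrite mulf_eq0 gt_eqF//= subr_eq0 => /eqP.
by rewrite lerD// ?ler_wpM2l// ?invr_ge0 ?ltW.
Qed.

End WeightedGeometricMean.

Lemma finite_set_uniform (T : choiceType) (D : set T) (Q : T -> nat -> Prop) :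
  finite_set D ->
  (forall x, D x -> exists n, forall m, (n <= m)%N -> Q x m) ->
  exists n, forall x, D x -> Q x n.
Proof.
move=> /finite_seqP[s ->] H.
suff: exists n, forall x, x \in s -> forall m, (n <= m)%N -> Q x m.
  by move=> [n Hn]; exists n => x xs; exact: (Hn x xs n).
elim: s H => [|x s IH] H; first by exists 0%N.
have [|n Hn] := IH.
  by move=> y ys; apply: H; rewrite /= inE ys orbT.
have [|m Hm] := H x; first by rewrite /= mem_head.
exists (maxn m n) => y; rewrite inE => /predU1P[->|ys] k; rewrite geq_max => /andP[mk nk].
  exact: Hm.
exact: Hn nk.
Qed.

Section Drift.
Context {R : realType} {S : countType} {P : S -> S -> R}.
Hypothesis hP : is_probability_kernel P.
Local Notation op := (kernel_op P).
Local Notation K := (kernel_pow P).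
Implicit Types (x y : S).

Lemma kernel_op_gt0 (f : S -> \bar R) y :
  (forall z, 0 < f z)%E -> (0 < op f y)%E.
Proof.
move=> f0; have : (0 < op (cst 1%E) y)%E by rewrite kernel_op1.
move=> /esum_gt0[z _]; rewrite mule1 => Pyz.
apply: lt_le_trans (kernel_op_ge hP y z (fun z => ltW (f0 z))).
by rewrite mule_gt0.
Qed.

(** Hoelder's inequality for the probability measure [P y]: integrating
    [geo_mean_le] with [a0] and [b0] equal to the two integrals turns the bracket
    there into 1. *)
Lemma kernel_op_geo_mean n (w f : S -> R) y (a b : R) :
    (forall z, 0 < w z) -> (forall z, 0 < f z) ->
    op (EFin \o w) y = a%:E -> op (EFin \o f) y = b%:E ->
  (op (fun z => (geo_mean n (w z) (f z))%:E) y <= (geo_mean n a b)%:E)%E.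
Proof.
move=> w0 f0 wa fb.
have ap : 0 < a by rewrite -lte_fin -wa kernel_op_gt0// => z; rewrite lte_fin.
have bp : 0 < b by rewrite -lte_fin -fb kernel_op_gt0// => z; rewrite lte_fin.
pose g := geo_mean n a b.
pose c := g * (n%:R / n.+1%:R / a); pose d := g * (n.+1%:R^-1 / b).
have g0 : 0 < g by exact: geo_mean_gt0.
have c0 : 0 <= c by rewrite /c mulr_ge0 ?divr_ge0// ltW.
have d0 : 0 <= d by rewrite /d mulr_ge0 ?divr_ge0 ?invr_ge0// ltW.
apply: (@le_trans _ _ (op (fun z => c%:E * (w z)%:E + d%:E * (f z)%:E) y)%E).
  apply: (le_kernel_op hP) => z; rewrite -!EFinM -EFinD lee_fin.
  apply: le_trans (geo_mean_le n (w0 z) (f0 z) ap bp) _.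
  by rewrite /c /d /g mulrDr !mulrA.
rewrite kernel_opD//; do 1?[by move=> z; rewrite mule_ge0 ?lee_fin// ltW].
rewrite !kernel_opZ//; do 1?[by move=> z; rewrite lee_fin ltW].
rewrite -[op (fun z => (w z)%:E) y]/(op (EFin \o w) y) wa.
rewrite -[op (fun z => (f z)%:E) y]/(op (EFin \o f) y) fb.
rewrite -!EFinM -EFinD lee_fin /c /d -/g.
have np : 0 < n.+1%:R :> R by rewrite ltr0n.
rewrite le_eqVlt; apply/orP; left; apply/eqP.
have nE : n.+1%:R = 1 + n%:R :> R by rewrite -natr1 addrC.
by move: np; rewrite nE => np; field; rewrite !gt_eqF.
Qed.

Lemma drift_condition_subset (A B : set S) : A `<=` B ->
  drift_condition P A -> drift_condition P B.
Proof.
move=> AB [f [e [f0 e01 fA fnA]]]; exists f, e; split=> // x.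
  move=> _; have [/fA//|/fnA h] := pselect (A x).
  by apply: le_lt_trans h _; rewrite ltry.
by move=> nB; apply: fnA => /AB.
Qed.

(** A drift function normalized to be 1 at [x] is a supersolution with
    [l = 1 / (1 - e)], and so dominates the generating function at [l]. *)
Lemma drift_condition_return_gen x : drift_condition P [set x] ->
  exists2 l : R, 1 < l & (return_gen P x l < +oo)%E.
Proof.
move=> [f [e [f0 /andP[e0 e1] fx fnx]]].
have e1' : 0 < 1 - e by rewrite subr_gt0.
pose l := (1 - e)^-1; exists l; first by rewrite invf_gt1// gtrBl.
have l0 : 0 < l by rewrite invr_gt0.
pose h y := ((f x)^-1%:E * (f y)%:E)%E.
have h0 y : (0 <= h y)%E by rewrite /h -EFinM lee_fin mulr_ge0 ?invr_ge0// ltW.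
have oph y : op h y = ((f x)^-1%:E * kernel_app P f y)%E.
  rewrite kernel_appE /h kernel_opZ ?invr_ge0 ?ltW// => z.
  by rewrite lee_fin ltW.
have le_h : forall y, (hit_gen P x l y <= h y)%E.
  apply: hit_gen_le => //; first exact: ltW.
    by rewrite /h -EFinM mulVf// gt_eqF.
  move=> y yx; rewrite oph muleCA /h lee_wpmul2l//.
    by rewrite lee_fin invr_ge0 ltW.
  apply: (@le_trans _ _ (l%:E * ((1 - e) * f y)%:E)%E).
    by rewrite lee_wpmul2l ?lee_fin ?(ltW l0)// fnx//=; apply/eqP.
  by rewrite -EFinM mulrA mulVf ?gt_eqF// mul1r.
rewrite -return_gen_step ?ltW//.
apply: (@le_lt_trans _ _ (l%:E * op h x)%E).
  by rewrite lee_wpmul2l ?lee_fin ?(ltW l0)// le_kernel_op.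
rewrite oph lte_mul_pinfty ?lee_fin ?(ltW l0)//.
by rewrite lte_mul_pinfty ?lee_fin ?invr_ge0 ?(ltW (f0 x))// fx.
Qed.

Hypothesis hirr : irreducible_kernel P.

(** The drift function is the generating function of the hitting time of [x]
    itself: off [x], one step of the kernel divides it by [l]. *)
Lemma return_gen_drift_condition x (l : R) : 1 < l ->
  (return_gen P x l < +oo)%E -> drift_condition P [set x].
Proof.
move=> l1 Foo; have l0 : 0 < l by exact: lt_trans l1.
pose f y := fine (hit_gen P x l y).
have fE y : (f y)%:E = hit_gen P x l y.
  by rewrite fineK// ge0_fin_numE ?hit_gen_ge0 ?(ltW l0)//; exact: hit_gen_lty.
have appE y : kernel_app P f y = op (hit_gen P x l) y.
  by rewrite kernel_appE; apply: eq_kernel_op => z; exact: fE.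
exists f, (1 - l^-1); split.
- by move=> y; rewrite -lte_fin fE hit_gen_gt0.
- by rewrite subr_gt0 invf_lt1// l1/= gtrBl invr_gt0.
- move=> _ ->; rewrite appE; move: Foo.
  rewrite -return_gen_step ?ltW//.
  apply: contraTT; rewrite -!leNgt !leye_eq => /eqP ->.
  by rewrite gt0_muley ?lte_fin.
- move=> y /eqP yx; rewrite appE subKr EFinM fE lee_pdivlMl//.
  by rewrite hit_gen_step// ltW.
Qed.

(** A drift function for a finite set controls nothing but finiteness on that
    set. It is combined with a bounded function, whose drift is strictly negative
    everywhere off [x], in a geometric mean that gives it a weight small enough
    for the bounded function to win on the finite set. *)
Lemma drift_condition_set1 (D : set S) x : finite_set D ->
  drift_condition P D -> drift_condition P [set x].
Proof.
move=> Dfin [f [e [f0 /andP[e0 e1] fD fnD]]].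
have e1' : 0 < 1 - e by rewrite subr_gt0.
have half0 : 0 <= 2^-1 :> R by [].
(* Off x, P u = 2 u > u; hence w = 2 - u has a strictly negative drift there.
   Any discount factor in ]0, 1[ would do. *)
pose u y := fine (hit_gen P x 2^-1 y).
have le1 y : (hit_gen P x 2^-1 y <= 1)%E.
  apply: le_trans (hit_gen1_le1 hP x y); apply: le_hit_gen => //.
  by rewrite half0 invf_le1// ler1n.
have uE y : (u y)%:E = hit_gen P x 2^-1 y.
  by rewrite fineK// ge0_fin_numE ?hit_gen_ge0// (le_lt_trans (le1 y))// ltry.
have u0 y : 0 < u y by rewrite -lte_fin uE hit_gen_gt0.
have u1 y : u y <= 1 by rewrite -lee_fin uE.
have opu0 y : (0 <= op (EFin \o u) y)%E.
  by apply: kernel_op_ge0 => // z; rewrite lee_fin ltW.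
pose w y := 2 - u y.
have w0 y : 0 < w y by rewrite /w; have := u1 y; lra.
have opw0 y : (0 <= op (EFin \o w) y)%E.
  by apply: kernel_op_ge0 => // z; rewrite lee_fin ltW.
have opwu y : (op (EFin \o w) y + op (EFin \o u) y = 2%:E)%E.
  rewrite -(kernel_op_cst hP y (c := 2)) ?ler0n//.
  rewrite -kernel_opD//; do 1?[by move=> z; rewrite lee_fin ltW].
  by apply: eq_kernel_op => z; rewrite /= -EFinD /w subrK.
pose a y := fine (op (EFin \o w) y).
have aE y : (op (EFin \o w) y = (a y)%:E)%E.
  rewrite fineK// ge0_fin_numE//; apply: (@le_lt_trans _ _ 2%:E); last exact: ltry.
  by rewrite -(opwu y) leeDl.
pose b y := fine (kernel_app P f y).
have bE y : kernel_app P f y = (b y)%:E.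
  rewrite fineK// ge0_fin_numE; last first.
    by rewrite kernel_appE kernel_op_ge0// => z; rewrite lee_fin ltW.
  have [/fD//|/fnD h] := pselect (D y).
  by apply: le_lt_trans h _; rewrite ltry.
have a0 y : 0 < a y by rewrite -lte_fin -aE kernel_op_gt0// => z; rewrite lte_fin.
have b0 y : 0 < b y.
  by rewrite -lte_fin -bE kernel_appE kernel_op_gt0// => z; rewrite lte_fin.
have aw y : y != x -> a y = w y - u y.
  move=> yx; have := hit_gen_step hP half0 yx.
  rewrite -(eq_kernel_op y uE) -uE => /(congr1 (fun t => 2%:E * t)%E).
  rewrite muleA -EFinM divff ?pnatr_eq0// mul1e => h.
  have := opwu y; rewrite aE h -EFinM -EFinD => -[] h2.
  by rewrite /w; lra.
(* In logarithms, the loss n * (ln w - ln (P w)) must exceed the possible gain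
   ln (P f) - ln f; the margin 1 makes the contraction uniform over D. *)
have [n Hn] : exists n, forall y, D y -> y != x ->
    ln (b y) - ln (f y) + 1 <= n%:R * (ln (w y) - ln (a y)).
  apply: finite_set_uniform => // y Dy.
  have [->|yx] := eqVneq y x; first by exists 0%N.
  have gap : 0 < ln (w y) - ln (a y).
    by rewrite subr_gt0 ltr_ln ?posrE// aw// gtrBl.
  exists (Num.bound ((ln (b y) - ln (f y) + 1) / (ln (w y) - ln (a y)))) => m Nm _.
  rewrite -ler_pdivrMr//.
  apply: le_trans (ler_norm _) _; apply: le_trans (ltW (archi_boundP (normr_ge0 _))) _.
  rewrite ler_nat; apply: leq_trans Nm.
  by rewrite /Num.bound normr_id.
(* The logarithm of the mean drops by at least 1 / n.+1 on D, and by at least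
   - ln (1 - e) / n.+1 off D. *)
pose c : R := Num.min 1 (- ln (1 - e)).
have c0 : 0 < c by rewrite lt_min ltr01/= oppr_gt0 ln_lt0// e1' gtrBl.
have np : 0 < n.+1%:R :> R by rewrite ltr0n.
pose d := expR (- c / n.+1%:R).
have d1 : d < 1 by rewrite expR_lt1 mulNr oppr_lt0 divr_gt0.
pose h y := geo_mean n (w y) (f y).
have le_h y : (kernel_app P h y <= (geo_mean n (a y) (b y))%:E)%E.
  rewrite kernel_appE; apply: kernel_op_geo_mean => //.
  by rewrite -kernel_appE.
exists h, (1 - d); split.
- by move=> y; exact: geo_mean_gt0.
- by rewrite subr_gt0 d1 gtrBl expR_gt0.
- by move=> y _; apply: le_lt_trans (le_h y) _; rewrite ltry.
- move=> y /eqP yx; apply: le_trans (le_h y) _; rewrite lee_fin subKr.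
  rewrite /h /d /geo_mean -expRD ler_expR -mulrDl ler_pM2r ?invr_gt0//.
  have [/Hn/(_ yx)|] := pselect (D y).
    rewrite mulrBr; have : c <= 1 by rewrite ge_min lexx.
    by lra.
  move=> nDy; have : c <= - ln (1 - e) by rewrite ge_min lexx orbT.
  have : n%:R * ln (a y) <= n%:R * ln (w y).
    by rewrite ler_wpM2l// ler_ln ?posrE// aw// gerBl ltW.
  have : ln (b y) <= ln (1 - e) + ln (f y).
    rewrite -lnM ?posrE// ler_ln ?posrE ?mulr_gt0// -lee_fin -bE.
    exact: fnD.
  by lra.
Qed.

End Drift.

(** * Return probabilities and the spectral radius *)

Section SupermultiplicativeSequences.
Context {R : realType}.
Implicit Types (a : nat -> R) (q : R).

Lemma root_exprn (c : R) n : 0 <= c -> (0 < n)%N -> (c ^+ n) `^ (n%:R^-1) = c.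
Proof.
by move=> c0 n0; rewrite -powR_mulrn// -powRrM divff ?powRr1// pnatr_eq0 -lt0n.
Qed.

(** Each [n] with [0 < a n] is a multiple of [m] above the least such index in its
    residue class modulo [m]. The factors [a m >= q ^+ m] cost no more than the
    geometric rate, and the starting values are finitely many positive numbers. *)
Lemma supermul_exprn_lower_bound a q : (forall n, 0 <= a n) ->
    (forall m n, a m * a n <= a (m + n)%N) -> 0 < q < 1 ->
    (exists2 m, (0 < m)%N & q ^+ m <= a m) ->
  exists2 c, 0 < c & forall n, 0 < a n -> c * q ^+ n <= a n.
Proof.
move=> a0 aM /andP[q0 q1] [m m0 am].
have iterM n0 j : a n0 * q ^+ (j * m) <= a (n0 + j * m)%N.
  elim: j => [|j IH]; first by rewrite mul0n addn0 mulr1.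
  rewrite mulSnr exprD mulrA addnA; apply: le_trans (aM _ _).
  by apply: ler_pM => //; rewrite ?mulr_ge0// exprn_ge0// ltW.
have [N HN] : exists N, forall r, `I_m r ->
    forall n, (n %% m)%N = r -> 0 < a n -> N.+1%:R^-1 * q ^+ n <= a n.
  apply: finite_set_uniform; first exact: finite_II.
  move=> r _; have [[n0 [n0r an0]]|no] := pselect (exists n, (n %% m)%N = r /\ 0 < a n);
    last by exists 0%N => M _ n nr an; exfalso; apply: no; exists n.
  have ex : exists n, [&& (n %% m == r)%N & 0 < a n] by exists n0; rewrite n0r eqxx.
  case: (ex_minnP ex) => n1 /andP[/eqP n1r an1] n1min.
  exists (Num.bound (a n1)^-1) => M NM n nr an.
  have n1n : (n1 <= n)%N by apply: n1min; rewrite nr eqxx.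
  have [j nE] : exists j, n = (n1 + j * m)%N.
    exists (n %/ m - n1 %/ m)%N; rewrite mulnBl.
    have h : (n1 %/ m * m <= n %/ m * m)%N by rewrite leq_mul2r leq_div2r ?orbT.
    move: h (divn_eq n m) (divn_eq n1 m); rewrite nr n1r.
    set u := (n %/ m * m)%N; set v := (n1 %/ m * m)%N => h -> ->.
    by rewrite addnAC subnKC.
  rewrite {2}nE; apply: le_trans (iterM n1 j).
  apply: ler_pM; rewrite ?invr_ge0 ?ler0n ?exprn_ge0 ?(ltW q0)//.
    rewrite -[leRHS]invrK lef_pV2 ?posrE ?invr_gt0 ?ltr0n//.
    apply: le_trans (ltW (archi_boundP _)) _; first by rewrite invr_ge0.
    by rewrite ler_nat ltnW.
  by apply: ler_wiXn2l; rewrite ?(ltW q0) ?(ltW q1)// nE leq_addl.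
exists N.+1%:R^-1 => [|n an]; first by rewrite invr_gt0 ltr0n.
exact: HN (ltn_pmod n m0) n erefl an.
Qed.

(** Up to a constant factor, whose [n]-th root tends to 1, the sequence is bounded
    below by [q ^+ n] for each [q < 1]. Indices with [a n = 0], which occur for
    periodic kernels, have to be left out. *)
Lemma supermul_root_cvg1 a : (forall n, 0 <= a n <= 1) ->
    (forall m n, a m * a n <= a (m + n)%N) ->
    (forall q, 0 < q < 1 -> exists2 m, (0 < m)%N & q ^+ m <= a m) ->
  a n `^ (n%:R^-1) @[n --> within [set n | 0 < a n] \oo] --> (1 : R).
Proof.
move=> a01 aM aq.
have a0 n : 0 <= a n by case/andP: (a01 n).
apply/cvgrPdist_le => e e0.
pose q := 1 - Num.min (e / 2) 2^-1.
have min0 : 0 < Num.min (e / 2) 2^-1 by rewrite lt_min divr_gt0// invr_gt0 ltr0n.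
have min1 : Num.min (e / 2) 2^-1 <= 2^-1 by rewrite ge_min lexx orbT.
have mine : Num.min (e / 2) 2^-1 <= e / 2 by rewrite ge_min lexx.
have q0 : 0 < q by rewrite /q; lra.
have q1 : q < 1 by rewrite /q; lra.
have q01 : 0 < q < 1 by rewrite q0.
have [c c0 ac] := supermul_exprn_lower_bound a0 aM q01 (aq _ q01).
have /cvgr_lt/(_ _ c0)[N _ HN] : (fun n => q ^+ n) @ \oo --> 0.
  by apply: cvg_expr; rewrite gtr0_norm.
rewrite near_withinE; exists N.+1 => // n Nn an.
have n0 : (0 < n)%N by exact: leq_trans Nn.
have Nqc : q ^+ n <= c by apply/ltW/HN; exact: ltnW.
(* One factor q absorbs the constant c, which exceeds q ^+ n for large n. *)
have lo : q ^+ 2 <= a n `^ n%:R^-1.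
  rewrite -(root_exprn (c := q ^+ 2) (n := n))//; last by rewrite exprn_ge0// ltW.
  apply: ge0_ler_powR; rewrite ?invr_ge0 ?ler0n// ?nnegrE ?exprn_ge0 ?(ltW q0)//.
  rewrite -exprM mulnC exprM expr2; apply: le_trans (ac n an).
  by rewrite ler_wpM2r// exprn_ge0// ltW.
have hi : a n `^ n%:R^-1 <= 1.
  rewrite [leRHS](_ : 1 = 1 `^ n%:R^-1); last by rewrite powR1.
  by apply: ge0_ler_powR; rewrite ?invr_ge0 ?ler0n// ?nnegrE//; case/andP: (a01 n).
have : 1 - e <= q ^+ 2.
  rewrite expr2 /q; set t := Num.min _ _ in mine min0 *.
  have : 0 <= t * t by rewrite mulr_ge0// ltW.
  by lra.
by rewrite ger0_norm ?subr_ge0//; lra.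
Qed.

End SupermultiplicativeSequences.

Section SpectralRadius.
Context {R : realType} {S : countType} {P : S -> S -> R}.
Hypothesis hP : is_probability_kernel P.
Hypothesis hirr : irreducible_kernel P.
Local Notation K := (kernel_pow P).
Implicit Types (x y : S).

Lemma return_times_infinite x N : exists2 n, (N <= n)%N & 0 < K n x x.
Proof.
have [n n0 Kn] := hirr x x; exists (N * n)%N; first by rewrite leq_pmulr.
elim: N => [|N IH]; first by rewrite /= eqxx ltr01.
rewrite mulSn; apply: lt_le_trans (kernel_pow_supermul hP n (N * n) x x x).
exact: mulr_gt0.
Qed.

Lemma return_times_filter x :
  ProperFilter (within [set n | 0 < K n x x] \oo).
Proof.
split; last exact: within_filter.
rewrite /within => -[N _ HN]; have [n Nn Kn] := return_times_infinite x N.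
exact: HN Nn Kn.
Qed.

Definition has_root_limit x (r : R) :=
  K n x x `^ (n%:R^-1) @[n --> within [set n | 0 < K n x x] \oo] --> r.

(** For [r != 0] the default value in the definition of [spectral_radius] is
    excluded. The state [x] is there because on an empty state space every number
    would be a limit. *)
Lemma spectral_radius_eq (x : S) (r : R) : r != 0 ->
  spectral_radius P = r <-> (forall y, has_root_limit y r).
Proof.
move=> r0; split.
  rewrite /spectral_radius; case: xgetP => [s -> hs <- //|_ /esym/eqP].
  by rewrite (negbTE r0).
move=> hr; apply: xget_unique => // s hs.
have pf := return_times_filter x.
apply: (@cvg_unique _ _ (fmap (fun n => K n x x `^ n%:R^-1)
  (within [set n | 0 < K n x x] \oo))).
- exact: norm_hausdorff.
- exact: hs.
- exact: hr.
Qed.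

Local Open Scope ereal_scope.

(** Summing the renewal equation over [n] gives
    [G = 1 + return_gen P x 1 * G = 1 + G] for the Green function [G]. *)
Lemma recurrent_green_infinite x : return_gen P x 1 = 1 ->
  \esum_(n in [set: nat]) (K n x x)%:E = +oo.
Proof.
move=> rec; have K0 n : 0 <= (K n x x)%:E by rewrite lee_fin kernel_pow_ge0.
have r0 := return_prob_ge0 hP x.
set G : \bar R := \esum_(n in _) _.
have G0 : 0 <= G by exact: esum_ge0.
have GE : G = 1 + G.
  rewrite {1}/G esum_nat_recl//=; rewrite eqxx; congr (_ + _).
  transitivity (\esum_(n in [set: nat]) \esum_(k in [set: nat])
      (if (k <= n)%N then return_prob P x k * (K (n - k) x x)%:E else 0)).
    apply: eq_esum => n _; rewrite return_prob_renewal//.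
    pose F k := return_prob P x k * (K (n - k) x x)%:E.
    rewrite (sum_ord_esum_nat (F := F))// => k.
    by rewrite mule_ge0.
  rewrite exchange_esum; last by move=> n k; case: ifP => // _; rewrite mule_ge0.
  transitivity (\esum_(k in [set: nat]) (return_prob P x k * G)).
    apply: eq_esum => k _.
    pose F n := return_prob P x k * (K n x x)%:E.
    rewrite (esum_nat_shift k (F := F)); last first.
      by move=> n; rewrite mule_ge0.
    have rk : return_prob P x k \is a fin_num.
      rewrite ge0_fin_numE//; apply: le_lt_trans (ltry 1); rewrite -rec.
      rewrite -[leLHS]mul1e -{1}(expr1n R k.+1).
      by apply: (@esum_ge1 _ _ _ (fun n => (1 ^+ n.+1)%:E * return_prob P x n)) => // j _;
        rewrite mule_ge0// lee_fin exprn_ge0.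
    by rewrite /F -(fineK rk) esumZl// fine_ge0.
  have [Gfin|] := boolP (G \is a fin_num).
    under eq_esum do rewrite muleC.
    rewrite -(fineK Gfin) esumZl ?fine_ge0// -[RHS]mule1 -rec; congr (_ * _).
    by apply: eq_esum => k _; rewrite expr1n mul1e.
  rewrite ge0_fin_numE// -leNgt leye_eq => /eqP ->.
  have : 0 < return_gen P x 1 by rewrite rec.
  move=> /esum_gt0[k _]; rewrite expr1n mul1e => rk.
  apply/eqP; rewrite -leye_eq -{1}(gt0_muley rk).
  apply: (@esum_ge1 _ _ setT (fun k => return_prob P x k * +oo)) => // j _.
  by rewrite mule_ge0.
have [Gfin|] := boolP (G \is a fin_num); last first.
  by rewrite ge0_fin_numE// -leNgt leye_eq => /eqP.
have : fine G = (1 + fine G)%R by apply: EFin_inj; rewrite EFinD fineK.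
by move=> /eqP; rewrite lt_eqF// ltrDr.
Qed.

(** A geometric bound at [y] would carry over to [x], by going from [y] to [x],
    round at [x], and back to [y]; then the Green function at [x] would be
    finite. *)
Lemma recurrent_no_geometric_decay x y (q : R) : return_gen P x 1 = 1 ->
  (0 < q < 1)%R -> exists2 m, (0 < m)%N & (q ^+ m <= K m y y)%R.
Proof.
move=> rec q01; have /andP[q0 q1] := q01.
apply: contrapT => no.
have decay m : (0 < m)%N -> (K m y y <= q ^+ m)%R.
  by move=> m0; rewrite leNgt; apply/negP => /ltW qK; apply: no; exists m.
have [k k0 Kk] := hirr y x; have [l _ Kl] := hirr x y.
pose c := (K k y x * K l x y)%R.
have c0 : (0 < c)%R by exact: mulr_gt0.
have bound n : (K n x x <= c^-1 * q ^+ n)%R.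
  rewrite mulrC ler_pdivlMr//.
  apply: (@le_trans _ _ (K (k + (n + l)) y y)).
    apply: le_trans (kernel_pow_supermul hP k (n + l) y y x).
    rewrite /c mulrCA ler_wpM2l ?kernel_pow_ge0//.
    exact: kernel_pow_supermul.
  apply: le_trans (decay _ _) _; first by rewrite addn_gt0 k0.
  by apply: ler_wiXn2l; rewrite ?(ltW q0) ?(ltW q1)//; lia.
have c1 : (0 <= c^-1)%R by rewrite invr_ge0 ltW.
have := geometric_esum_lty c1 q01.
apply/negP; rewrite -leNgt -(recurrent_green_infinite rec).
by apply: le_esum => n _; rewrite lee_fin.
Qed.

Lemma recurrent_spectral_radius1 x : return_gen P x 1 = 1 ->
  spectral_radius P = 1%R.
Proof.
move=> rec; apply/(spectral_radius_eq x (oner_neq0 R)) => y.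
apply: supermul_root_cvg1.
- by move=> n; rewrite kernel_pow_ge0//= kernel_pow_le1.
- by move=> m n; exact: kernel_pow_supermul.
- by move=> q; exact: recurrent_no_geometric_decay rec.
Qed.

(** If the return probabilities summed to less than 1, then the generating
    function would still be at most 1 at some [z > 1], and the renewal equation
    would bound [K n x x] by [z ^- n]. *)
Lemma spectral_radius1_recurrent x (l : R) : spectral_radius P = 1%R ->
  (1 < l)%R -> return_gen P x l < +oo -> return_gen P x 1 = 1.
Proof.
move=> rho1 l1 Foo; apply/eqP; rewrite eq_le return_gen1_le1//= leNgt.
apply/negP => F1.
have r0 := return_prob_ge0 hP x.
have F_ge0 z : (0 <= z)%R -> 0 <= return_gen P x z.
  by move=> z0; apply: esum_ge0 => n _; rewrite mule_ge0// lee_fin exprn_ge0.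
have l0 : (0 < l)%R by exact: lt_trans l1.
have [z z1 Fz] : exists2 z : R, (1 < z)%R & return_gen P x z <= 1.
  pose u := fine (return_gen P x 1); pose v := fine (return_gen P x l).
  have uE : u%:E = return_gen P x 1.
    by rewrite fineK// ge0_fin_numE ?F_ge0// (lt_trans F1)// ltry.
  have vE : v%:E = return_gen P x l.
    by rewrite fineK// ge0_fin_numE// F_ge0// ltW.
  have v0 : (0 <= v)%R by rewrite -lee_fin vE F_ge0// ltW.
  have u1 : (u < 1)%R by rewrite -lte_fin uE.
  have u0 : (0 <= u)%R by rewrite -lee_fin uE F_ge0.
  (* F is at most (1 - t) * u + t * v at the point 1 + t * (l - 1), by convexity
     of the powers; this value of t makes the bound at most 1. *)
  pose t : R := ((1 - u) / (1 + v))%R.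
  have t0 : (0 < t)%R by rewrite divr_gt0//; lra.
  have t1 : (t <= 1)%R by rewrite ler_pdivrMr; lra.
  have tv : (t * v <= 1 - u)%R.
    by rewrite /t -mulrA ler_piMr//; [lra|rewrite mulrC ler_pdivrMr; lra].
  exists (1 + t * (l - 1))%R.
    by rewrite ltrDl mulr_gt0// subr_gt0.
  apply: (@le_trans _ _ ((1 - t)%:E * return_gen P x 1 + t%:E * return_gen P x l)).
    have cvx n : ((1 + t * (l - 1)) ^+ n <= (1 - t) + t * l ^+ n)%R.
      elim: n => [|n IH]; first by rewrite !expr0; lra.
      rewrite exprS.
      apply: (@le_trans _ _ ((1 + t * (l - 1)) * ((1 - t) + t * l ^+ n))%R).
        by rewrite ler_wpM2l// addr_ge0// mulr_ge0 ?subr_ge0// ltW.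
      have h1 : (1 <= l ^+ n)%R by rewrite exprn_ege1// ltW.
      have : (0 <= (t * (1 - t)) * ((l - 1) * (l ^+ n - 1)))%R.
        by apply: mulr_ge0; apply: mulr_ge0; rewrite ?subr_ge0 ?(ltW t0) ?(ltW l1).
      by rewrite exprS; lra.
    have pos z n : (0 <= z)%R -> [set: nat] n -> 0 <= (z ^+ n.+1)%:E * return_prob P x n.
      by move=> z0 _; rewrite mule_ge0// lee_fin exprn_ge0.
    rewrite /return_gen -(esumZl (c := 1 - t)) ?subr_ge0//; last by move=> n; exact: pos.
    rewrite -(esumZl (c := t)) ?(ltW t0)//; last by move=> n; apply: pos; exact: ltW.
    rewrite -esumD; last 2 first.
    - by move=> n _; rewrite mule_ge0 ?pos// lee_fin subr_ge0.
    - by move=> n _; rewrite mule_ge0 ?pos// ?lee_fin ltW.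
    apply: le_esum => n _; rewrite !muleA -!EFinM -ge0_muleDl ?lee_fin; last 2 first.
    - by rewrite expr1n mulr1 subr_ge0.
    - by rewrite mulr_ge0 ?exprn_ge0// ltW.
    by rewrite expr1n mulr1 -EFinD lee_wpmul2r// lee_fin.
  rewrite -uE -vE -!EFinM -EFinD lee_fin.
  have : (0 <= t * u)%R by rewrite mulr_ge0// ltW.
  by lra.
have z0 : (0 < z)%R by exact: lt_trans z1.
have decay n : (K n x x * z ^+ n <= 1)%R.
  elim/ltn_ind: n => -[_|n IH]; first by rewrite /= eqxx mulr1.
  rewrite -lee_fin EFinM return_prob_renewal// ge0_sume_distrl; last first.
    by move=> i _; rewrite mule_ge0// lee_fin kernel_pow_ge0.
  apply: le_trans Fz.
  apply: le_trans (le_sum_esum_nat n.+1 _); last first.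
    by move=> k; rewrite mule_ge0// lee_fin exprn_ge0// ltW.
  apply: lee_sum => k _.
  have kn : (k <= n)%N by rewrite -ltnS.
  have -> : (z ^+ n.+1 = z ^+ (n - k) * z ^+ k.+1)%R by rewrite -exprD addnS subnK.
  rewrite -muleA -EFinM mulrA.
  rewrite muleC lee_wpmul2r// lee_fin -[leRHS]mul1r ler_wpM2r ?exprn_ge0 ?(ltW z0)//.
  by apply: IH; rewrite ltnS leq_subr.
have /(spectral_radius_eq x (oner_neq0 R))/(_ x) := rho1.
have zlt1 : (z^-1 < 1)%R by rewrite invf_lt1.
have pf := return_times_filter x.
move=> /cvgr_gt/(_ _ zlt1); rewrite near_withinE => -[N _ HN].
have [n Nn Kn] := return_times_infinite x N.+1.
have n0 : (0 < n)%N by exact: leq_trans Nn.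
have /= := HN n (ltnW Nn) Kn; apply/negP; rewrite -leNgt.
rewrite -(root_exprn (c := z^-1%R) _ n0); last by rewrite invr_ge0 ltW.
apply: ge0_ler_powR; rewrite ?invr_ge0 ?ler0n// ?nnegrE ?kernel_pow_ge0//.
  by rewrite exprn_ge0// invr_ge0 ltW.
by rewrite exprVn -[leRHS]mul1r ler_pdivlMr ?exprn_gt0.
Qed.

End SpectralRadius.

(** * Measures and integrals along countable partitions *)

Section CountablePartitions.
Context {R : realType}.
Local Open Scope ereal_scope.

Lemma esum_pickle_inv (S : countType) (a : S -> \bar R) :
  \esum_(i in [set: nat]) oapp a 0 (@pickle_inv S i) = \esum_(z in [set: S]) a z.
Proof.
transitivity (\esum_(i in pickle @` [set: S]) oapp a 0 (@pickle_inv S i)).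
  rewrite [RHS]esum_mkcond; apply: eq_esum => i _.
  case: ifPn => // /negP; rewrite inE.
  have := pickle_invK (T := S) i; case: (@pickle_inv S i) => //= z zi h.
  by exfalso; apply: h; exists z.
rewrite esum_image; last by move=> z1 z2 _ _ /(pcan_inj (@pickleK S)).
by apply: eq_esum => z _; rewrite pickleK_inv.
Qed.

Lemma measure_countable_bigcup d (T : measurableType d)
    (mu : {measure set T -> \bar R}) (S : countType) (F : S -> set T) :
    (forall z, measurable (F z)) ->
    (forall y z w, F y w -> F z w -> y = z) ->
  mu (\bigcup_z F z) = \esum_(z in [set: S]) mu (F z).
Proof.
move=> mF dF; pose G i := oapp F set0 (@pickle_inv S i).
have mG i : measurable (G i).
  by rewrite /G; case: pickle_inv => [z|] /=; [exact: mF|exact: measurable0].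
have -> : \bigcup_z F z = \bigcup_i G i.
  apply/seteqP; split => [w [z _ Fz]|w [i _]].
    by exists (pickle z) => //; rewrite /G pickleK_inv.
  by rewrite /G; case: pickle_inv => //= z Fz; exists z.
rewrite measure_semi_bigcup//; last 2 first.
- apply/trivIsetP => i j _ _ ij; apply/eqP/negPn/negP => /set0P[w []].
  rewrite /G; have := pickle_invK (T := S) i; have := pickle_invK (T := S) j.
  case: pickle_inv => [y|] //=; case: pickle_inv => [z|] //= yj zi Fz Fy.
  by move: ij; rewrite -yj -zi (dF _ _ _ Fz Fy) eqxx.
- exact: bigcupT_measurable.
rewrite nneseries_esumT; last by move=> i; exact: measure_ge0.
rewrite -[RHS]esum_pickle_inv; apply: eq_esum => i _.
by rewrite /G; case: pickle_inv => //=; rewrite measure0.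
Qed.

Lemma integral_countable_partition d (T : measurableType d)
    (mu : {measure set T -> \bar R}) (G : nat -> set T) (f : T -> \bar R)
    (c : nat -> \bar R) :
    (forall i, measurable (G i)) -> (forall i j w, G i w -> G j w -> i = j) ->
    (forall w, exists i, G i w) ->
    (forall i w, G i w -> f w = c i) -> (forall i, 0 <= c i) ->
  \int[mu]_w f w = \esum_(i in [set: nat]) (c i * mu (G i)).
Proof.
move=> mG dG cG fc c0.
have GT : \bigcup_i G i = setT.
  by apply/seteqP; split => // w _; have [i Gi] := cG w; exists i.
have mf : measurable_fun setT f.
  move=> _ Y mY; rewrite setTI.
  have -> : f @^-1` Y = \bigcup_(i in [set i | Y (c i)]) G i.
    apply/seteqP; split => [w Yw|w [i /= Yi Gi]].
      have [i Gi] := cG w; exists i => //=.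
      by rewrite -(fc _ _ Gi).
    by rewrite /= (fc _ _ Gi).
  by apply: bigcup_measurable.
rewrite -GT ge0_integral_bigcup//; last 3 first.
- by rewrite GT.
- by move=> w _; have [i Gi] := cG w; rewrite (fc _ _ Gi).
- apply/trivIsetP => i j _ _ ij; apply/eqP/negPn/negP => /set0P[w [Gi Gj]].
  by move: ij; rewrite (dG _ _ _ Gi Gj) eqxx.
rewrite nneseries_esumT; last first.
  by move=> i; apply: integral_ge0 => w Gi; rewrite (fc _ _ Gi).
apply: eq_esum => i _; rewrite -integral_cst//.
by apply: eq_integral => w /set_mem; exact: fc.
Qed.

Lemma probability_setI1 d (T : measurableType d) (Pr : probability T R)
    (A B : set T) : measurable A -> measurable B -> Pr B = 1 ->
  Pr (A `&` B) = Pr A.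
Proof.
move=> mA mB B1.
have -> : Pr A = Pr (A `\` B) + Pr (A `&` B) by exact: measureDI.
suff -> : Pr (A `\` B) = 0 by rewrite add0e.
apply/eqP; rewrite eq_le measure_ge0 andbT.
have <- : Pr (~` B) = 0 by rewrite probability_setC// B1 subee.
by apply: le_measure; rewrite ?inE; [exact: measurableD|exact: measurableC|move=> w []].
Qed.

End CountablePartitions.

(** * The law of the return time *)

Section ReturnTimeLaw.
Context {R : realType} {S : countType} {P : S -> S -> R}.
Hypothesis hP : is_probability_kernel P.
Context {x : S} {d : measure_display} {T : measurableType d}.
Context {Pr : probability T R} {X : nat -> T -> S}.
Hypothesis hX : markov_chain P x Pr X.
Local Open Scope ereal_scope.

Let cylinder n (s : nat -> S) :=
  [set w | forall k, (k <= n)%N -> X k w = s k].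

Let first_visit n m :=
  [set w | (forall j, (j < m)%N -> X (n + j) w != x) /\ X (n + m) w = x].

Let measurable_state k y : measurable [set w | X k w = y].
Proof. by case: hX => /(_ k y). Qed.

Let measurable_state_neq k y : measurable [set w | X k w != y].
Proof.
have -> : [set w | X k w != y] = ~` [set w | X k w = y].
  by apply/seteqP; split => w /eqP.
exact: measurableC.
Qed.

Let measurable_forall (Q : nat -> set T) : (forall k, measurable (Q k)) ->
  measurable [set w | forall k, Q k w].
Proof.
move=> mQ; have -> : [set w | forall k, Q k w] = \bigcap_k Q k.
  by apply/seteqP; split => w h k => //; exact: h.
exact: bigcapT_measurable.
Qed.

Let measurable_imply (b : bool) (Q : set T) : measurable Q ->
  measurable [set w | b -> Q w].
Proof.
case: b => mQ.
  by have -> : [set w | true -> Q w] = Q by apply/seteqP; split => w h //; exact: h.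
by have -> : [set w | false -> Q w] = setT by apply/seteqP.
Qed.

Let measurable_cylinder n s : measurable (cylinder n s).
Proof.
apply: measurable_forall => k.
exact: (@measurable_imply (k <= n)%N _ (measurable_state k (s k))).
Qed.

Let measurable_first_visit n m : measurable (first_visit n m).
Proof.
apply: (measurableI [set w | forall j, (j < m)%N -> X (n + j) w != x]
  [set w | X (n + m) w = x]) => //.
apply: measurable_forall => k.
exact: (@measurable_imply (k < m)%N _ (measurable_state_neq (n + k) x)).
Qed.

(** The Markov property is given for cylinders only, so the cylinder is refined
    according to the next state before the induction hypothesis applies. *)
Let prob_first_visit_step n s m :
  (forall s', Pr (cylinder n.+1 s' `&` first_visit n.+1 m) =
     Pr (cylinder n.+1 s') * hit_prob P x m (s' n.+1)) ->
  Pr (cylinder n s `&` first_visit n.+1 m) =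
    Pr (cylinder n s) * kernel_op P (hit_prob P x m) (s n).
Proof.
move=> IH.
pose upd z k := if (k <= n)%N then s k else z.
have updE z : cylinder n.+1 (upd z) = cylinder n s `&` [set w | X n.+1 w = z].
  apply/seteqP; split => w /=.
    move=> h; split => [k kn|]; first by rewrite h ?(leqW kn)// /upd kn.
    by rewrite h// /upd ltnn.
  move=> [h1 h2] k; rewrite leq_eqVlt => /predU1P[->|kn].
    by rewrite /upd ltnn.
  by rewrite h1// /upd -ltnS kn.
have -> : cylinder n s `&` first_visit n.+1 m =
    \bigcup_z (cylinder n.+1 (upd z) `&` first_visit n.+1 m).
  apply/seteqP; split => [w [cw fw]|w [z _]].
    by exists (X n.+1 w) => //; rewrite updE.
  by rewrite updE => -[[]].
have -> : Pr (\bigcup_z (cylinder n.+1 (upd z) `&` first_visit n.+1 m)) =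
    \esum_(z in [set: S]) Pr (cylinder n.+1 (upd z) `&` first_visit n.+1 m).
  apply: measure_countable_bigcup => [z|y z w]; first exact: measurableI.
  by rewrite !updE => -[[_ /= <-] _] [[_ /= <-] _].
have PrE : Pr (cylinder n s) = (fine (Pr (cylinder n s)))%:E.
  by rewrite fineK// fin_num_measure.
rewrite PrE -esumZl ?fine_ge0//; last first.
  by move=> z _; rewrite mule_ge0 ?lee_fin ?(kernel_ge0 hP)// hit_prob_ge0.
rewrite -PrE; apply: eq_esum => z _; rewrite IH updE muleA.
case: hX => _ _ /(_ n s z) ->.
by rewrite /upd ltnn.
Qed.

Let prob_cylinder_first_visit n s m :
  Pr (cylinder n s `&` first_visit n m) = Pr (cylinder n s) * hit_prob P x m (s n).
Proof.
elim: m n s => [|m IH] n s.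
  rewrite /=; have [snx|snx] := eqVneq (s n) x.
    rewrite mule1; congr (Pr _); apply/seteqP; split => w; first by case.
    by move=> cw; split => //; split => //; rewrite addn0 cw.
  rewrite mule0 (_ : _ `&` _ = set0) ?measure0//.
  apply/seteqP; split => // w [cw [_]].
  by rewrite addn0 cw// => /eqP; rewrite (negbTE snx).
have [snx|snx] := eqVneq (s n) x.
  rewrite snx hit_probS_self mule0 (_ : _ `&` _ = set0) ?measure0//.
  apply/seteqP; split => // w [cw [/(_ 0%N isT)]].
  by rewrite addn0 cw// snx eqxx.
rewrite hit_probS// -prob_first_visit_step//; congr (Pr _).
apply/seteqP; split => w [cw [h1 h2]]; split => //; split.
- by move=> j jm; rewrite addSnnS; apply: h1.
- by rewrite addSnnS.
- by move=> [_|j jm]; [rewrite addn0 cw|rewrite -addSnnS; exact: h1].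
- by rewrite -addSnnS.
Qed.

Lemma prob_first_return m :
  Pr [set w | (forall j, (j < m)%N -> X j.+1 w != x) /\ X m.+1 w = x] =
  return_prob P x m.
Proof.
rewrite -[LHS]/(Pr (first_visit 1 m)).
have X0 : cylinder 0 (fun=> x) = [set w | X 0%N w = x].
  apply/seteqP; split => w /=; first by move=> h; exact: (h 0%N isT).
  by move=> h [|k].
have X01 : Pr (cylinder 0 (fun=> x)) = 1 by rewrite X0; case: hX.
rewrite -(probability_setI1 (measurable_first_visit 1 m) (measurable_cylinder 0 _) X01).
by rewrite setIC prob_first_visit_step ?X01 ?mul1e.
Qed.

Let never := [set w | forall j, X j.+1 w != x].

Let measurable_never : measurable never.
Proof.
apply: (@measurable_forall (fun j => [set w | X j.+1 w != x])) => j.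
exact: measurable_state_neq.
Qed.

(** Index 0 stands for the event of no return, so that the return times become
    the indices. *)
Let first_return_partition i :=
  if i is m.+1 then first_visit 1 m else never.

Let first_return_cover w : exists i, first_return_partition i w.
Proof.
have [h|] := pselect (exists j, X j.+1 w == x); last first.
  by move=> h; exists 0%N => j; apply/negP => hj; apply: h; exists j.
case: (ex_minnP h) => m /eqP Xm mmin; exists m.+1; split => // j jm.
by apply/negP => /mmin; rewrite leqNgt jm.
Qed.

Let first_return_disjoint i j w :
  first_return_partition i w -> first_return_partition j w -> i = j.
Proof.
have aux m k : first_visit 1 m w -> first_visit 1 k w -> (m <= k)%N.
  move=> [h _] [_ Xk]; rewrite leqNgt; apply/negP => /h.
  by rewrite Xk eqxx.
case: i => [|i]; case: j => [|j] //=.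
- by move=> h [_]; move/eqP; rewrite (negbTE (h j)).
- by move=> [_ Xi] h; move/eqP: Xi; rewrite (negbTE (h i)).
- by move=> h1 h2; congr _.+1; apply/eqP; rewrite eqn_leq !aux.
Qed.

Let return_time_first_visit m w : first_visit 1 m w ->
  return_time R X x w = (m.+1%:R)%:E.
Proof.
move=> [h Xm]; apply/eqP; rewrite eq_le; apply/andP; split.
  by apply: ereal_inf_lbound; exists m.+1.
apply: le_ereal_inf_tmp => _ [[|k] [//= _ Xk] <-].
rewrite lee_fin ler_nat ltnS leqNgt; apply/negP => /h.
by rewrite add1n Xk eqxx.
Qed.

Let return_time_never w : never w -> return_time R X x w = +oo.
Proof.
move=> h; rewrite /return_time (_ : [set _ | _ in _] = set0) ?ereal_inf0//.
apply/seteqP; split => // _ [[|k] [//= _ Xk] _].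
by have := h k; rewrite Xk eqxx.
Qed.

(** The event of no return has probability [1 - return_gen P x 1]; the term
    [+oo * 0] is 0 in the recurrent case. *)
Lemma exp_return_time_integral (e : R) : (0 < e)%R ->
  \int[Pr]_w expeR (e%:E * return_time R X x w) =
  +oo * (1 - return_gen P x 1) + return_gen P x (expR e).
Proof.
move=> e0.
have G0 i : 0 <= Pr (first_return_partition i) by exact: measure_ge0.
have mG i : measurable (first_return_partition i).
  by case: i => [|i] /=; [exact: measurable_never|exact: measurable_first_visit].
have return1 : return_gen P x 1 = \esum_(m in [set: nat]) Pr (first_visit 1 m).
  by apply: eq_esum => m _; rewrite expr1n mul1e -prob_first_return.
have neverE : Pr never = 1 - return_gen P x 1.
  have : \esum_(i in [set: nat]) Pr (first_return_partition i) = 1.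
    have <- : Pr (\bigcup_i first_return_partition i) = 1.
      rewrite -[RHS](probability_setT Pr); congr (Pr _).
      by apply/seteqP; split => // w _; have [i Gi] := first_return_cover w; exists i.
    by apply/esym; exact: measure_countable_bigcup.
  rewrite esum_nat_recl//= -return1 => <-.
  rewrite addeK// ge0_fin_numE; last by rewrite return1 esum_ge0.
  by apply: le_lt_trans (return_gen1_le1 hP x) _; rewrite ltry.
pose c i : \bar R := if i is m.+1 then (expR e ^+ m.+1)%:E else +oo.
rewrite (@integral_countable_partition _ _ _ Pr first_return_partition _ c)//.
- rewrite esum_nat_recl; last first.
    by case=> [|i]; rewrite mule_ge0//= lee_fin exprn_ge0// expR_ge0.
  rewrite /= neverE; congr (_ + _); apply: eq_esum => m _.
  by rewrite -prob_first_return.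
- case=> [|m] w /=.
    by move/return_time_never => ->; rewrite gt0_muley ?lte_fin.
  move/return_time_first_visit => ->.
  by rewrite -EFinM /= expRM_natr.
- by case=> [|m] //=; rewrite lee_fin exprn_ge0// expR_ge0.
Qed.

End ReturnTimeLaw.

(** * Existence of the chain *)

Section UniformOnUnitInterval.
Context {R : realType}.
Local Open Scope ereal_scope.

Definition unit_interval : set R := `[0%R, 1%R[%classic.

Lemma measurable_unit_interval : measurable unit_interval.
Proof. exact: measurable_itv. Qed.

(** Lebesgue measure is restricted rather than transported to a subtype, so the
    sample space is the real line and the points outside the interval carry no
    mass. *)
Definition unit_measure : set (measurableTypeR R) -> \bar R :=
  mrestr (@lebesgue_measure R) measurable_unit_interval.

HB.instance Definition _ := Measure.on unit_measure.

Let unit_measure_setT : unit_measure setT = 1.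
Proof.
rewrite /unit_measure /mrestr setTI lebesgue_measure_itv/= lte_fin ltr01.
by rewrite oppr0 adde0.
Qed.

HB.instance Definition _ :=
  Measure_isProbability.Build _ _ _ unit_measure unit_measure_setT.

Lemma unit_measure_itv (a b : R) (A : set R) : (0 <= a)%R -> (a <= b)%R ->
  (forall u, (0 <= u < 1)%R /\ A u <-> (a <= u < b)%R) ->
  unit_measure A = (b - a)%:E.
Proof.
move=> a0 ab AE; rewrite /unit_measure /mrestr.
have -> : A `&` unit_interval = `[a, b[%classic.
  apply/seteqP; split => u /=.
    by rewrite /unit_interval /= !in_itv/= => -[Au uD]; apply/AE.
  by rewrite in_itv/= => /AE[uD Au]; rewrite /unit_interval /= in_itv.
rewrite lebesgue_measure_itv/= lte_fin.
have [->|anb] := eqVneq a b; first by rewrite ltxx subrr.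
by rewrite lt_neqAle anb ab EFinB.
Qed.

End UniformOnUnitInterval.

Section ChainConstruction.
Context {R : realType} {S : countType} {P : S -> S -> R}.
Hypothesis hP : is_probability_kernel P.
Implicit Types (s x y : S) (u : R).

(** With the states ordered by their codes, these sums cut the unit interval into
    one cell of length [P s y] for each state [y]. *)
Let cumul s n : R := \sum_(i < n) oapp (P s) 0 (@pickle_inv S i).

Let oapp_ge0 s i : 0 <= oapp (P s) 0 (@pickle_inv S i).
Proof. by case: pickle_inv => //= z; exact: kernel_ge0. Qed.

Let cumul_le s : {homo cumul s : m n / (m <= n)%N >-> m <= n}.
Proof.
apply: homo_leq => //; first exact: le_trans.
move=> n.
by rewrite /cumul big_ord_recr/= lerDl.
Qed.

Let esum_cumul s :
  (\esum_(i in [set: nat]) (oapp (P s) 0 (@pickle_inv S i))%:E = 1)%E.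
Proof.
case: hP => _ /(_ s) <-; rewrite -esum_pickle_inv; apply: eq_esum => i _.
by case: pickle_inv.
Qed.

Let cumul_le1 s n : cumul s n <= 1.
Proof.
rewrite -lee_fin -(esum_cumul s) /cumul -sumEFin.
by apply: le_sum_esum_nat => i; rewrite lee_fin.
Qed.

Let cumul_gt s u : u < 1 -> exists n, u < cumul s n.
Proof.
move=> u1; apply: contrapT => no.
suff : (1 <= u%:E)%E by rewrite lee_fin leNgt u1.
rewrite -(esum_cumul s); apply: esum_nat_le => n; first by rewrite lee_fin.
by rewrite sumEFin lee_fin leNgt; apply/negP => h; apply: no; exists n.
Qed.

Let left_end s y := cumul s (pickle y).

Let left_endS s y : cumul s (pickle y).+1 = left_end s y + P s y.
Proof. by rewrite /cumul big_ord_recr/= pickleK_inv. Qed.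

Let left_end_ge0 s y : 0 <= left_end s y.
Proof. by have := cumul_le s (leq0n (pickle y)); rewrite {1}/cumul big_ord0. Qed.

Let right_end_le1 s y : left_end s y + P s y <= 1.
Proof. by rewrite -left_endS. Qed.

Let cell s y u := left_end s y <= u < left_end s y + P s y.

Let cell_exists s u : 0 <= u < 1 -> exists y, cell s y u.
Proof.
move=> /andP[u0 u1]; case: (ex_minnP (cumul_gt s u1)) => -[|n] un nmin.
  by move: un; rewrite /cumul big_ord0 ltNge u0.
have nu : cumul s n <= u by rewrite leNgt; apply/negP => /nmin; rewrite ltnn.
have := pickle_invK (T := S) n; case E: pickle_inv => [y|] /= yn.
  by exists y; rewrite /cell -left_endS /left_end yn nu.
by move: un; rewrite /cumul big_ord_recr/= E addr0 ltNge nu.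
Qed.

Let cell_unique s y z u : cell s y u -> cell s z u -> y = z.
Proof.
have aux y' z' : cell s y' u -> cell s z' u -> (pickle z' <= pickle y')%N.
  rewrite /cell -!left_endS => /andP[_ uy] /andP[uz _].
  rewrite leqNgt; apply/negP => /(cumul_le s).
  by rewrite leNgt (le_lt_trans uz uy).
move=> yu zu; apply: (pcan_inj (@pickleK S)).
by apply/eqP; rewrite eqn_leq !aux.
Qed.

Let letter s u : S := xget s [set y | cell s y u].

Let letterE s y u : cell s y u -> letter s u = y.
Proof.
by move=> yu; apply: xget_unique => // z zu; exact: cell_unique yu.
Qed.

(** The affine map from the cell of [y] onto the unit interval. Given that a
    uniform point lies in the cell, its image is again uniform; the chain iterates
    this map and records the cells. *)
Let rescale s y u := (u - left_end s y) / P s y.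

Let cell_gt0 s y u : cell s y u -> 0 < P s y.
Proof.
by move=> /andP[h1 h2]; have := le_lt_trans h1 h2; rewrite ltrDl.
Qed.

Let rescale_itv s y u a b : 0 < P s y ->
  (a <= rescale s y u < b) =
  (left_end s y + a * P s y <= u < left_end s y + b * P s y).
Proof.
move=> p0; rewrite /rescale ler_pdivlMr// ltr_pdivrMr//.
by rewrite lerBrDl ltrBlDl.
Qed.

Let cell_rescale s y u : 0 < P s y -> cell s y u = (0 <= rescale s y u < 1).
Proof. by move=> p0; rewrite rescale_itv// mul0r addr0 mul1r. Qed.

Fixpoint chain_state (n : nat) s u : S :=
  if n is m.+1 then
    let y := letter s u in chain_state m y (rescale s y u)
  else s.

Let path_prob n (w : nat -> S) : R := \prod_(k < n) P (w k) (w k.+1).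

Let path_prob_ge0 n w : 0 <= path_prob n w.
Proof. by apply: prodr_ge0 => k _; exact: kernel_ge0. Qed.

Let cell_unit s y u : cell s y u -> 0 <= u < 1.
Proof.
move=> /andP[h1 h2]; rewrite (le_trans (left_end_ge0 s y) h1).
exact: lt_le_trans h2 (right_end_le1 s y).
Qed.

(** The points following a given path form an interval whose length is the
    probability of the path, by induction on the path: prepending a state pulls
    the interval back through an affine map of slope [1 / P s y]. A path of
    probability 0 gives an empty interval. *)
Let cylinder_itv n (w : nat -> S) : exists a,
  [/\ 0 <= a, a + path_prob n w <= 1 &
      forall u, 0 <= u < 1 /\
          (forall k, (k <= n)%N -> chain_state k (w 0%N) u = w k) <->
        a <= u < a + path_prob n w].
Proof.
elim: n w => [|n IH] w.
  exists 0; rewrite /path_prob big_ord0 add0r; split => // u.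
  by split => [[]//|u01]; split => // -[|k].
have [a [a0 a1 aE]] := IH (fun k => w k.+1).
set q := path_prob n _ in a1 aE.
have q0 : 0 <= q by exact: path_prob_ge0.
pose p := P (w 0%N) (w 1%N); pose l := left_end (w 0%N) (w 1%N).
have -> : path_prob n.+1 w = p * q by rewrite /path_prob big_ord_recl.
have l0 : 0 <= l by exact: left_end_ge0.
have lp1 : l + p <= 1 by exact: right_end_le1.
have stepE u : 0 <= u < 1 /\
      (forall k, (k <= n.+1)%N -> chain_state k (w 0%N) u = w k) <->
    cell (w 0%N) (w 1%N) u /\
      (forall k, (k <= n)%N ->
         chain_state k (w 1%N) (rescale (w 0%N) (w 1%N) u) = w k.+1).
  split => [[u01 h]|[cu h]].
    have [y yu] := cell_exists (w 0%N) u01.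
    have yw : y = w 1%N by rewrite -(h 1%N isT) /= (letterE yu).
    rewrite yw in yu; split => // k kn.
    by rewrite -(h k.+1 kn) /= (letterE yu).
  split; first exact: cell_unit cu.
  move=> [|k] kn //=; rewrite (letterE cu); exact: h.
have : 0 <= p by exact: kernel_ge0.
rewrite le_eqVlt => /predU1P[p0|p0].
  exists 0; rewrite -p0 mul0r addr0; split => // u.
  split => [/stepE[/cell_gt0]|/andP[h1 h2]].
    by rewrite -/p -p0 ltxx.
  by have := le_lt_trans h1 h2; rewrite ltxx.
exists (l + a * p); split.
- by rewrite addr_ge0// mulr_ge0// ltW.
- apply: le_trans lp1; rewrite -addrA lerD2l [p * q]mulrC -mulrDl.
  by rewrite -[leRHS]mul1r ler_wpM2r// ltW.
- move=> u; rewrite -addrA [p * q]mulrC -mulrDl -rescale_itv// -/q.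
  split => [/stepE[cu h]|/aE[ru h]].
    by apply/aE; split => //; rewrite -cell_rescale.
  by apply/stepE; split => //; rewrite cell_rescale.
Qed.

Let measurable_chain_state n s y :
  measurable (unit_interval `&` [set u | chain_state n s u = y]).
Proof.
elim: n s => [|n IH] s /=.
  have [->|sy] := eqVneq s y.
    rewrite (_ : [set _ | _] = setT) ?setIT; last by apply/seteqP.
    exact: measurable_unit_interval.
  rewrite (_ : [set _ | _] = set0) ?setI0//.
  by apply/seteqP; split => // u /= /eqP; rewrite (negbTE sy).
have -> : unit_interval `&`
    [set u | chain_state n (letter s u) (rescale s (letter s u) u) = y] =
  \bigcup_z (`[left_end s z, left_end s z + P s z[%classic `&`
    rescale s z @^-1` (unit_interval `&` [set v | chain_state n z v = y])).
  apply/seteqP; split => u.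
    move=> [] /=; rewrite /unit_interval/= in_itv/= => u01.
    have [z zu] := cell_exists s u01; rewrite (letterE zu) => h.
    exists z => //; split; first by rewrite /= in_itv.
    by split => //=; rewrite in_itv/= -cell_rescale// (cell_gt0 zu).
  move=> [z _ [] /=]; rewrite in_itv/= => zu [_ h].
  by split; [rewrite /unit_interval/= in_itv/=; exact: cell_unit zu|rewrite (letterE zu)].
apply: countable_bigcupT_measurable; first exact: countableP.
move=> z; apply: measurableI; first exact: measurable_itv.
have mr : measurable_fun setT (rescale s z).
  apply: measurable_funM; last exact: measurable_cst.
  by apply: measurable_funB; [exact: measurable_id|exact: measurable_cst].
by rewrite -[X in measurable X]setTI; apply: mr.
Qed.

(** Outside the unit interval the chain is constant, for the sake of
    measurability only. *)
Definition unit_chain x (n : nat) (u : measurableTypeR R) : S :=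
  if u \in unit_interval then chain_state n x u else x.

Lemma unit_chain_markov x : markov_chain P x (@unit_measure R) (unit_chain x).
Proof.
have inD u : 0 <= u < 1 -> (u \in (unit_interval : set R)).
  by move=> u01; rewrite inE /unit_interval/= in_itv.
have cylE n (w : nat -> S) (A : set R) : w 0%N = x ->
    (forall u, 0 <= u < 1 ->
      (A u <-> forall k, (k <= n)%N -> unit_chain x k u = w k)) ->
    unit_measure A = (path_prob n w)%:E.
  move=> w0 AE; have [a [a0 _ aE]] := cylinder_itv n w.
  rewrite (@unit_measure_itv _ a (a + path_prob n w))//.
  - by rewrite addrC addKr.
  - by rewrite lerDl.
  - move=> u; rewrite -aE w0; split => -[u01].
      by move=> /(AE _ u01) h; split => // k /h; rewrite /unit_chain inD.
    by move=> h; split => //; apply/(AE _ u01) => k /h; rewrite /unit_chain inD.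
split.
- move=> k y; have -> : [set u | unit_chain x k u = y] =
      (unit_interval `&` [set u | chain_state k x u = y]) `|`
      (~` unit_interval `&` [set u | x = y]).
    apply/seteqP; split => u; rewrite /unit_chain /=.
      by case: ifPn; rewrite ?inE ?notin_setE => uD; [left|right].
    case=> -[uD].
      by rewrite mem_set.
    by rewrite memNset.
  apply: measurableU; first exact: measurable_chain_state.
  apply: measurableI; first by apply: measurableC; exact: measurable_unit_interval.
  have [->|xy] := eqVneq x y.
    by rewrite (_ : [set _ | _] = setT)//; apply/seteqP.
  rewrite (_ : [set _ | _] = set0)//.
  by apply/seteqP; split => // u /= /eqP; rewrite (negbTE xy).
- rewrite -[LHS]/(unit_measure [set u | unit_chain x 0 u = x]).
  rewrite (cylE 0%N (fun=> x))// ?/path_prob ?big_ord0// => u u01 /=.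
  by split => [h [|k] //|h]; exact: (h 0%N isT).
- move=> n s y; have [s0|s0] := eqVneq (s 0%N) x; last first.
    have E : [set u | forall k, (k <= n)%N -> unit_chain x k u = s k] = set0.
      apply/seteqP; split => // u /= /(_ 0%N isT) h.
      by move: s0; rewrite -h /unit_chain /=; case: ifP; rewrite eqxx.
    by rewrite E set0I measure0 mul0e.
  pose w k := if (k <= n)%N then s k else y.
  transitivity ((path_prob n s)%:E * (P (s n) y)%:E)%E; last first.
    by congr (_ * _)%E; apply/esym; exact: cylE.
  transitivity (path_prob n.+1 w)%:E.
    apply: (cylE n.+1 w); first by rewrite /w s0.
    move=> u u01 /=; split => [[h1 h2] k|h].
      by rewrite leq_eqVlt ltnS /w => /predU1P[->|kn]; rewrite ?ltnn// kn h1.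
    split; last by rewrite h// /w ltnn.
    by move=> k kn; rewrite h ?(leqW kn)// /w kn.
  rewrite -EFinM; congr EFin; rewrite /path_prob big_ord_recr/=.
  have wn : w n = s n by rewrite /w leqnn.
  have wS : w n.+1 = y by rewrite /w ltnn.
  rewrite wn wS; congr (_ * _); apply: eq_bigr => k _.
  by rewrite /w ltn_ord (ltnW (ltn_ord k)).
Qed.

End ChainConstruction.

(** * The theorem *)

Theorem corollary8 (R : realType) (S : countType) (P : S -> S -> R)
    (S' : set S) (hP : is_probability_kernel P) (hirr : irreducible_kernel P)
    (hfin : finite_set S') (hne : S' !=set0) :
  strongly_positive_recurrent P <->
  (spectral_radius P = 1 /\
   exists (f : S -> R) (e : R),
     [/\ forall x, 0 < f x,
         0 < e < 1,
         forall x, S' x -> (kernel_app P f x < +oo)%E &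
         forall x, ~ S' x -> (kernel_app P f x <= ((1 - e) * f x)%:E)%E]).
Proof.
have [a S'a] := hne.
split => [[x [e [e0 [d [T [Pr [X [hX]]]]]]]]|[rho1 drift]].
  rewrite (exp_return_time_integral hP hX e0) => fin.
  have F0 z : 0 <= z -> (0 <= return_gen P x z)%E.
    move=> z0; apply: esum_ge0 => n _.
    by rewrite mule_ge0 ?(return_prob_ge0 hP)// lee_fin exprn_ge0.
  have Fe : (return_gen P x (expR e) < +oo)%E.
    apply: le_lt_trans fin; rewrite leeDr// mule_ge0//.
    by rewrite sube_ge0 ?orbT// (return_gen1_le1 hP).
  have rec : return_gen P x 1 = 1%E.
    apply/eqP; rewrite eq_le (return_gen1_le1 hP)/= leNgt; apply/negP => F1.
    move: fin; rewrite gt0_mulye ?sube_gt0// addye ?ltxx//.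
    by rewrite gt_eqF// (lt_le_trans _ (F0 _ (expR_ge0 e))).
  split; first exact: (recurrent_spectral_radius1 hP hirr rec).
  have e1 : 1 < expR e by rewrite expR_gt1.
  have := return_gen_drift_condition hP hirr e1 Fe.
  move=> /(drift_condition_set1 hP hirr a (finite_set1 x)).
  by apply: drift_condition_subset => // _ ->.
have := drift_condition_set1 hP hirr a hfin drift.
move=> /(drift_condition_return_gen hP)[l l1 Fl].
have rec := spectral_radius1_recurrent hP hirr rho1 l1 Fl.
have l0 : 0 < l by exact: lt_trans l1.
exists a, (ln l); split; first by rewrite ln_gt0.
exists _, (measurableTypeR R), (@unit_measure R), (@unit_chain R S P a).
split; first exact: unit_chain_markov.
rewrite (exp_return_time_integral hP (unit_chain_markov hP a)) ?ln_gt0//.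
by rewrite rec subee// mule0 add0e lnK.
Qed.
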